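(* Let $q\ge1$ and let $a=(a(n))_{n\ge1}$, $b=(b(n))_{n\ge1}$ be real sequences which are periodic of period $q$, i.e. $a(n+q)=a(n)$ and $b(n+q)=b(n)$ for all $n\ge1$, with $a(n)>0$ for all $n$. Let $J=J(a,b)$ be the associated Jacobi matrix, let $A_q=[a(1)a(2)\cdots a(q)]^{1/q}$, and let $B_1,B_2,\dots,B_q$ be the bands of $J$, ordered from right to left. Then for every $j=1,2,\dots,q$ \[ |B_j|\;\le\;2A_q\left[\cos\frac{\pi(j-1)}{q}-\cos\frac{\pi j}{q}\right], \] and equality is attained if and only if $a$ and $b$ are constant sequences.
   Context: The Jacobi matrix $J=J(a,b)$ is the bounded self-adjoint operator on $\ell^2(\mathbb{N})$, $\mathbb{N}=\{1,2,\dots\}$, given by $(J\psi)(n)=a(n-1)\psi(n-1)+a(n)\psi(n+1)+b(n)\psi(n)$ for $n\ge 1$, with $\psi(0)=0$. Bands. Setting $a(0)=a(q)$, the discriminant of the $q$-periodic operator is \[\Delta(E)=\operatorname{tr}\left[\begin{pmatrix}\frac{E-b(q)}{a(q)}&-\frac{a(q-1)}{a(q)}\\1&0\end{pmatrix}\cdots\begin{pmatrix}\frac{E-b(1)}{a(1)}&-\frac{a(0)}{a(1)}\\1&0\end{pmatrix}\right],\] a real polynomial of degree $q$ in $E$ with leading coefficient $A_q^{-q}$. By Bloch–Floquet theory, the essential support $\Sigma_{\mathrm{ac}}(J)$ of the absolutely continuous spectrum of $J$ equals (up to sets of measure zero) $\{E\in\mathbb{R}:|\Delta(E)|\le2\}$,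 and this set is the union of $q$ closed intervals (the bands), which may overlap only at their edges; the bands are the closures of the $q$ connected components of $\{E\in\mathbb{R}:|\Delta(E)|<2\}$. They are numbered $B_1,\dots,B_q$ from right to left. $|\cdot|$ denotes length. *)

(* Defs.v *)
From HB Require Import structures.
From mathcomp Require Import all_boot all_order all_algebra.
From mathcomp Require Import all_classical all_reals all_analysis.

Set Implicit Arguments.
Unset Strict Implicit.
Unset Printing Implicit Defensive.

Import Order.TTheory GRing.Theory Num.Theory.
Import numFieldNormedType.Exports.

Local Open Scope classical_set_scope.
Local Open Scope ring_scope.

(* Coefficient sequences are functions nat -> R of which only the values at
   n >= 1 are meaningful: no definition below depends on a 0 or b 0. *)

Definition periodic_seq (R : realType) (q : nat) (u : nat -> R) : Prop :=
  forall n, (1 <= n)%N -> u (n + q)%N = u n.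

Definition constant_seq (R : realType) (u : nat -> R) : Prop :=
  exists c, forall n, (1 <= n)%N -> u n = c.

Definition geomean (R : realType) (q : nat) (a : nat -> R) : R :=
  (\prod_(1 <= n < q.+1) a n) `^ (q%:R^-1).

(* The value a(0), which enters the first transfer matrix, is set to a(q). *)
Definition a_ext (R : realType) (q : nat) (a : nat -> R) (n : nat) : R :=
  if n == 0%N then a q else a n.

Definition transfer (R : realType) (q : nat) (a b : nat -> R) (E : R) (n : nat)
    : 'M[R]_2 :=
  \matrix_(i, k)
    if i == 0 then
      if k == 0 then (E - b n) / a n else - (a_ext q a n.-1 / a n)
    else (k == 0)%:R.

(* The product T_n(E) *m ... *m T_1(E). *)
Fixpoint monodromy (R : realType) (q : nat) (a b : nat -> R) (E : R) (n : nat)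
    : 'M[R]_2 :=
  if n is m.+1 then transfer q a b E m.+1 *m monodromy q a b E m else 1%:M.

Definition discriminant (R : realType) (q : nat) (a b : nat -> R) (E : R) : R :=
  \tr (monodromy q a b E q).

(* The interiors of the bands of J(a, b): the connected components of
   {E | |Delta(E)| < 2}, whose closures have as union {E | |Delta(E)| <= 2},
   the essential support of the absolutely continuous spectrum of J(a, b). *)
Definition open_bands (R : realType) (q : nat) (a b : nat -> R)
    : set (set R) :=
  let S := [set E : R | `|discriminant q a b E| < 2] in
  [set connected_component S E | E in S].

Definition left_of (R : realType) (C D : set R) : Prop :=
  forall x y, C x -> D y -> x < y.

(* Bands are numbered from 1, so the j-th one from the right is the closure of
   the component that has exactly j - 1 components to its right. *)
Definition is_band (R : realType) (q : nat) (a b : nat -> R) (j : nat)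
    (B : set R) : Prop :=
  exists C : set R,
    [/\ open_bands q a b C,
        ([set D | open_bands q a b D /\ left_of C D] #= `I_(j.-1))%card
      & B = closure C].

(* At most one B satisfies is_band. If there were none, the value would be the
   whole line, so an upper bound on the length of [band q a b j] also asserts
   that the j-th band exists. *)
Definition band (R : realType) (q : nat) (a b : nat -> R) (j : nat) : set R :=
  xget setT [set B | is_band q a b j B].

(* Main.v *)
Require Import Defs.
From HB Require Import structures.
From mathcomp Require Import all_boot all_order all_algebra.
From mathcomp Require Import all_classical all_reals all_analysis.
From mathcomp Require Import polyrcf.
From mathcomp Require Import ring lra zify.

Set Implicit Arguments.
Unset Strict Implicit.
Unset Printing Implicit Defensive.

Import Order.TTheory GRing.Theory Num.Theory.
Import numFieldNormedType.Exports.

Local Open Scope classical_set_scope.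
Local Open Scope ring_scope.

(** Let psi be the Floquet solution at an energy E inside a band, and let
    phi_n in (0, pi) be the argument of psi_(n+1) / psi_n.  The current
    J = a(n) |psi_n| |psi_(n+1)| sin phi_n does not depend on n, and the total
    phase theta = phi_0 + ... + phi_(q-1) satisfies Delta = 2 cos theta and
    d theta / d E = - (sum of |psi_n|^2) / (2 J).  Multiplying the q expressions
    for J, the AM-GM inequality for the |psi_n|^2 and the concavity of log sin
    give J <= A_q (sum of |psi_n|^2 / q) sin (theta / q), that is, the function
    2 A_q cos (theta / q) of E has derivative at least 1; its derivative is 1
    only if all |psi_n| and all phi_n agree, which forces a and b to be constant.
    By Sturm oscillation theta runs through (pi (j - 1), pi j) on the j-th band
    from the right, and the mean value theorem concludes. *)

(** The phase is not followed continuously in E: Floquet data are chosen separately at each energy.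
    On the band of index i the phase equals [i%:R * pi + acos ((-1) ^+ i * D.[x] / 2)], so its
    differentiability only concerns a polynomial and [acos], and the Floquet data serve to evaluate
    that derivative. The formula is singular where |Delta| = 2; hence all estimates are made inside
    open bands, and a length is handled as the least upper bound of the differences y - x. A strict
    inequality then needs a deficit that is uniform in x and y. Neighbouring bands may touch, so
    gaps cannot be assumed to be open. The bands are separated instead by the roots of [u N.+1], the
    energies at which the monodromy matrix is triangular: there |Delta| >= 2, whether the gap is
    open or closed. *)

(** * Roots of real polynomials with prescribed alternating signs *)

Lemma sign_prod_sub (R : realDomainType) (z : nat -> R) (N k : nat) (x : R) :
  (k <= N)%N -> (forall i, (i < k)%N -> x < z i) ->
  (forall i, (k <= i < N)%N -> z i <= x) ->
  0 <= (-1) ^+ k * \prod_(i < N) (x - z i).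
Proof.
elim: N k => [|N IH] k kN above below.
  by move: kN; rewrite leqn0 => /eqP ->; rewrite big_ord0 mulr1.
rewrite big_ord_recr /= mulrA.
have [kN'|Nk] := leqP k N.
  apply: mulr_ge0; last by rewrite subr_ge0 below// kN' /=.
  by apply: IH => // i /andP[ki iN]; rewrite below// ki ltnW.
have -> : k = N.+1 by lia.
have -> : (-1) ^+ N.+1 * \prod_(i < N) (x - z i) * (x - z N) =
    (-1) ^+ N * \prod_(i < N) (x - z i) * (z N - x) by rewrite exprS; ring.
apply: mulr_ge0; last by rewrite subr_ge0 ltW// above//; lia.
apply: IH => // i iN; [by apply: above; lia | by lia].
Qed.

Lemma decreasing_lt (R : porderType ring_display) (N : nat) (z : nat -> R) (i j : nat) :
  (forall k, (k.+1 < N)%N -> z k.+1 < z k) -> (i < j < N)%N -> z j < z i.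
Proof.
move=> zdec; elim: j => // j IH /andP[ij jN].
have [->|ne] := eqVneq i j; first exact: zdec.
by apply: lt_trans (zdec _ jN) (IH _); lia.
Qed.

Lemma decreasing_inj (R : porderType ring_display) (N : nat) (z : nat -> R) (i j : nat) :
  (forall k, (k.+1 < N)%N -> z k.+1 < z k) -> (i < N)%N -> (j < N)%N ->
  z i = z j -> i = j.
Proof.
move=> zdec iN jN e; have [ij|ji|//] := ltngtP i j.
  by have := decreasing_lt zdec (introT andP (conj ij jN)); rewrite e ltxx.
by have := decreasing_lt zdec (introT andP (conj ji iN)); rewrite e ltxx.
Qed.

Lemma poly_sign_at_ninfty (R : realType) (p : {poly R}) (n : nat) :
  size p = n.+2 -> 0 < lead_coef p ->
  exists M, forall x, x <= M -> 0 < (-1) ^+ n.+1 * p.[x].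
Proof.
move=> sp lp; pose r := (-1) ^+ n.+1 *: (p \Po (- 'X)).
have sgn0 : (-1 : R) ^+ n.+1 != 0 by rewrite signr_eq0.
have sr : size r = n.+2.
  by rewrite size_scale// size_comp_poly2 ?sp// size_polyN size_polyX.
have lr : lead_coef r = lead_coef p.
  rewrite lead_coefZ lead_coef_comp ?size_polyN ?size_polyX//.
  rewrite lead_coefN lead_coefX sp /= mulrCA -exprMn mulrNN mulr1 expr1n.
  by rewrite mulr1.
have [|M hM] := @poly_pinfty_gt_lc _ r; first by rewrite lr.
exists (- M) => x xM.
have := hM (- x); rewrite lerNr => /(_ xM); rewrite lr /r hornerZ horner_comp.
by rewrite hornerN hornerX opprK; exact: lt_le_trans.
Qed.

(** The signs at the [m] points [y i], with those near plus and minus infinity, give [m.+1] sign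
    changes, hence [m.+1] roots; as this is the degree, there are no others. It is applied both to
    the Dirichlet polynomials and to Delta - c. *)
Lemma alternating_roots (R : realType) (p : {poly R}) (m : nat) (y : nat -> R) :
  size p = m.+2 -> 0 < lead_coef p ->
  (forall i, (i.+1 < m)%N -> y i.+1 < y i) ->
  (forall i, (i < m)%N -> 0 < (-1) ^+ i.+1 * p.[y i]) ->
  exists z : nat -> R,
    [/\ p = lead_coef p *: \prod_(i < m.+1) ('X - (z i)%:P),
        (forall i, (i < m)%N -> z i.+1 < y i < z i) &
        forall i, (i < m)%N -> z i.+1 < z i].
Proof.
move=> sp lp ydec ysgn.
have [M0 hM0] := poly_pinfty_gt_lc lp.
have [L0 hL0] := poly_sign_at_ninfty sp lp.
(* [M] and [L] lie beyond all [y i] and far enough out for the leading term to fix the sign; the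
   entry [M - 1] keeps [L] below [M] when [m = 0]. *)
pose M := Num.max M0 (y 0%N + 1).
pose L := Num.min L0 (Num.min (M - 1) (y m.-1 - 1)).
pose t i := if i == 0%N then M else if (i <= m)%N then y i.-1 else L.
have tsgn i : (i <= m.+1)%N -> 0 < (-1) ^+ i * p.[t i].
  rewrite /t; case: i => [|i] /= im.
    rewrite expr0 mul1r; apply: lt_le_trans lp _; apply: hM0.
    by rewrite le_max lexx.
  have [i_m|m_i] := ltnP i m; first exact: ysgn.
  have -> : i = m by lia.
  by apply: hL0; rewrite ge_min lexx.
have tdec i : (i <= m)%N -> t i.+1 < t i.
  rewrite /t; case: i => [|i] /= im.
    case: ifP => m0; first by rewrite lt_max; apply/orP; right; lra.
    by rewrite !gt_min; apply/orP; right; apply/orP; left; lra.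
  rewrite im; case: ifP => im'; first exact: ydec.
  have -> : i = m.-1 by lia.
  by rewrite !gt_min; apply/orP; right; apply/orP; right; lra.
have /choice[z zP] : forall i, exists z, (i <= m)%N ->
    [/\ t i.+1 < z, z < t i & root p z].
  move=> i; have [im|] := leqP i m; last by exists 0.
  have ivt : p.[t i.+1] * p.[t i] < 0.
    have h1 := tsgn _ (leqW im); have h2 := tsgn i.+1 im.
    have e : (-1) ^+ i * p.[t i] * ((-1) ^+ i.+1 * p.[t i.+1]) =
        - (((-1) ^+ i) ^+ 2 * (p.[t i.+1] * p.[t i])) by rewrite exprS; ring.
    by have := mulr_gt0 h1 h2; rewrite e sqrr_sign mul1r oppr_gt0.
  have [z] := poly_ivtoo (ltW (tdec _ im)) ivt.
  by rewrite in_itv /= => /andP[? ?] ?; exists z.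
have zy i : (i < m)%N -> z i.+1 < y i < z i.
  move=> im; have [_ a _] := zP i.+1 im; have [b _ _] := zP i (ltnW im).
  by move: a b; rewrite /t /= im => -> ->.
have zdec i : (i < m)%N -> z i.+1 < z i.
  by move=> /zy /andP[]; exact: lt_trans.
exists z; split => //.
have zE (f : {poly R}) : f = lead_coef f *: \prod_(x <- [seq z i | i <- iota 0 m.+1]) ('X - x%:P)
    -> f = lead_coef f *: \prod_(i < m.+1) ('X - (z i)%:P).
  by rewrite big_map -[iota 0 m.+1]/(index_iota 0 m.+1) big_mkord.
apply: zE; apply: all_roots_prod_XsubC.
- by rewrite size_map size_iota.
- by apply/allP => x /mapP[i]; rewrite mem_iota => im ->; case: (zP i im).
- rewrite uniq_rootsE map_inj_in_uniq ?iota_uniq// => i j.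
  rewrite !mem_iota /= !add0n => im jm.
  by apply: (@decreasing_inj _ m.+1) => // k; rewrite ltnS; exact: zdec.
Qed.

(** * Interlacing of the roots of the Dirichlet solutions *)

Section JacobiSolutions.
Variables (R : realType) (al b : nat -> R).
Hypothesis al_gt0 : forall n, 0 < al n.

(** Solutions of the eigenvalue equation as polynomials in the energy, which makes degree, roots and
    the derivative in E available algebraically. *)
Fixpoint jacobi_sol (p0 p1 : {poly R}) (n : nat) : {poly R} :=
  match n with
  | 0%N => p0
  | n'.+1 => match n' with
    | 0%N => p1
    | m.+1 => (al n')^-1 *: (('X - (b n')%:P) * jacobi_sol p0 p1 n'
                             - al m *: jacobi_sol p0 p1 m)
    end
  end.

Lemma jacobi_solE p0 p1 n x :
  al n.+1 * (jacobi_sol p0 p1 n.+2).[x] =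
  (x - b n.+1) * (jacobi_sol p0 p1 n.+1).[x] - al n * (jacobi_sol p0 p1 n).[x].
Proof.
rewrite [jacobi_sol _ _ n.+2]/= -/(jacobi_sol p0 p1 n.+1) hornerZ.
by rewrite mulVKf ?gt_eqF// !hornerE.
Qed.

Lemma deriv_jacobi_solE p0 p1 n x :
  al n.+1 * (jacobi_sol p0 p1 n.+2)^`().[x] =
  (jacobi_sol p0 p1 n.+1).[x] + (x - b n.+1) * (jacobi_sol p0 p1 n.+1)^`().[x]
  - al n * (jacobi_sol p0 p1 n)^`().[x].
Proof.
rewrite [jacobi_sol _ _ n.+2]/= -/(jacobi_sol p0 p1 n.+1).
rewrite derivZ hornerZ mulVKf ?gt_eqF// derivB derivM derivXsubC derivZ.
by rewrite !hornerE.
Qed.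

Definition dirichlet_sol := jacobi_sol 0 1.
Definition neumann_sol := jacobi_sol 1 0.

Let u := dirichlet_sol.
Let v := neumann_sol.

Lemma jacobi_wronskian n x :
  al n * ((u n.+1).[x] * (v n).[x] - (v n.+1).[x] * (u n).[x]) = al 0.
Proof.
elim: n => [|n IH]; first by rewrite /u /v /= !hornerE; ring.
rewrite -IH mulrBr !mulrA /u /v !jacobi_solE; ring.
Qed.

Lemma dirichlet_sol_size n :
  [/\ size (u n) = n, size (u n.+1) = n.+1 & 0 < lead_coef (u n.+1)].
Proof.
elim: n => [|n [s0 s1 l1]].
  by rewrite /u /= size_poly0 size_poly1 lead_coef1 ltr01.
have nz : ('X - (b n.+1)%:P) * u n.+1 != 0.
  by rewrite mulf_neq0// -size_poly_gt0 ?size_XsubC ?s1.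
have sM : size (('X - (b n.+1)%:P) * u n.+1) = n.+2.
  by rewrite size_monicM ?monicXsubC ?size_XsubC ?s1// -size_poly_gt0 s1.
have lt_size : (size (- (al n *: u n)) < size (('X - (b n.+1)%:P) * u n.+1)%R)%N.
  by rewrite size_polyN sM (leq_ltn_trans (size_scale_leq _ _))// s0; lia.
have a_gt0 : 0 < (al n.+1)^-1 by rewrite invr_gt0.
have uE : u n.+2 = (al n.+1)^-1 *: (('X - (b n.+1)%:P) * u n.+1 - al n *: u n) by [].
split=> //.
- by rewrite uE size_scale ?gt_eqF// size_polyDl.
- rewrite uE lead_coefZ lead_coefDl// lead_coef_monicM ?monicXsubC//.
  exact: mulr_gt0.
Qed.

Lemma neumann_sol_size n : (size (v n) <= n.+1)%N && (size (v n.+1) <= n.+1)%N.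
Proof.
elim: n => [|n /andP[s0 s1]]; first by rewrite /v /= size_poly0 size_poly1.
rewrite (leq_trans s1)//=.
rewrite [v n.+2]/= (leq_trans (size_scale_leq _ _))//.
rewrite (leq_trans (size_polyD _ _))// geq_max size_polyN.
rewrite (leq_trans (size_polyMleq _ _)) ?size_XsubC /=; last first.
  by rewrite !ltnS.
by rewrite (leq_trans (size_scale_leq _ _))// (leq_trans s0).
Qed.

Definition roots_of_degree n (p : {poly R}) (z : nat -> R) :=
  p = lead_coef p *: \prod_(i < n) ('X - (z i)%:P).

Lemma roots_of_degree_sign n p z k x : roots_of_degree n p z ->
  0 < lead_coef p -> (k <= n)%N -> (forall i, (i < k)%N -> x < z i) ->
  (forall i, (k <= i < n)%N -> z i <= x) -> 0 <= (-1) ^+ k * p.[x].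
Proof.
move=> pE lp kn above below.
have -> : p.[x] = lead_coef p * \prod_(i < n) (x - z i).
  by rewrite {1}pE hornerZ horner_prod; congr (_ * _); apply: eq_bigr => i _;
    rewrite !hornerE.
by rewrite mulrCA mulr_ge0 ?sign_prod_sub// ltW.
Qed.

Lemma roots_of_degree_root n p z x : roots_of_degree n p z -> p != 0 ->
  p.[x] = 0 -> exists2 i, (i < n)%N & x = z i.
Proof.
move=> pE p0 /eqP; rewrite pE hornerZ horner_prod mulf_eq0 lead_coef_eq0.
rewrite (negbTE p0) => /prodf_eq0[i _]; rewrite !hornerE subr_eq0 => /eqP.
by exists i.
Qed.

Lemma roots_of_degreeP n p z i : roots_of_degree n p z -> (i < n)%N -> p.[z i] = 0.
Proof.
move=> -> ni; rewrite hornerZ horner_prod (bigD1 (Ordinal ni))//=.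
by rewrite hornerXsubC subrr mul0r mulr0.
Qed.

(** The index is shifted because [u n.+1] has degree [n]. The interlacing condition also forces both
    lists to be strictly decreasing. *)
Definition interlaced_roots n (yz : (nat -> R) * (nat -> R)) :=
  [/\ roots_of_degree n (u n.+1) yz.1, roots_of_degree n.+1 (u n.+2) yz.2 &
      forall i, (i < n)%N -> yz.2 i.+1 < yz.1 i < yz.2 i].

(** At a root of [u n.+2] the recurrence makes [u n.+3] a negative multiple of [u n.+1]. The sign of
    the latter is known from the interlacing, and it cannot vanish there because the Wronskian is
    nonzero; so [u n.+3] alternates at these roots. *)
Lemma interlaced_rootsS n yz : interlaced_roots n yz ->
  exists z, interlaced_roots n.+1 (yz.2, z).
Proof.
case: yz => y y' [/= yR y'R int].
have y'dec i : (i.+1 < n.+1)%N -> y' i.+1 < y' i.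
  by rewrite ltnS => /int/andP[]; exact: lt_trans.
have [s0 s1 l1] := dirichlet_sol_size n.+2.
have [_ _ l0] := dirichlet_sol_size n.
have [i ni|z [zR zint _]] := alternating_roots s1 l1 y'dec.
- have y'0 := roots_of_degreeP y'R ni.
  have ge0 : 0 <= (-1) ^+ i * (u n.+1).[y' i].
    apply: (roots_of_degree_sign yR) => //.
    + move=> j ji; have [|y'y _] := andP (int j _); first by lia.
      apply: le_lt_trans y'y; have [->//|ne] := eqVneq i j.+1.
      by apply/ltW/(decreasing_lt y'dec); lia.
    + move=> j /andP[ij jn]; have [_ yy'] := andP (int j jn).
      apply: (le_trans (ltW yy')); have [->//|ne] := eqVneq i j.
      by apply/ltW/(decreasing_lt y'dec); lia.
  have ne0 : (u n.+1).[y' i] != 0.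
    apply/eqP => u0; have := jacobi_wronskian n.+1 (y' i).
    by rewrite -/u y'0 u0 mul0r mulr0 subrr mulr0 => /eqP; rewrite lt_eqF.
  have gt0 : 0 < (-1) ^+ i * (u n.+1).[y' i].
    by rewrite lt_def ge0 mulf_neq0// signr_eq0.
  have := jacobi_solE 0 1 n.+1 (y' i); rewrite -/dirichlet_sol -/u y'0 mulr0 sub0r => e.
  rewrite -(pmulr_rgt0 _ (al_gt0 n.+2)) mulrCA e exprS.
  have -> : -1 * (-1) ^+ i * - (al n.+1 * (u n.+1).[y' i]) =
     al n.+1 * ((-1) ^+ i * (u n.+1).[y' i]) by ring.
  exact: mulr_gt0.
- by exists z; split.
Qed.

Lemma dirichlet_roots_interlace : exists nu : nat -> nat -> R,
  forall n, interlaced_roots n (nu n, nu n.+1).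
Proof.
have [z0 z0P] : exists z, interlaced_roots 0 ((fun=> 0), z).
  have [_ s1 l1] := dirichlet_sol_size 1.
  have [//|//|z [zR _ _]] := @alternating_roots R _ 0 (fun=> 0) s1 l1.
  exists z; split => //=.
  by rewrite /roots_of_degree big_ord0 /u /= lead_coef1 scale1r.
(* Each list of roots is built from the previous one, so choice is applied to the one-step
   extension, made total by the value 0 on pairs that do not interlace, and the result is
   iterated. *)
have /choice[f fP] : forall nyz : nat * ((nat -> R) * (nat -> R)), exists z,
    interlaced_roots nyz.1 nyz.2 -> interlaced_roots nyz.1.+1 (nyz.2.2, z).
  move=> [n yz] /=; have [h|h] := pselect (interlaced_roots n yz).
    by have [z zP] := interlaced_rootsS h; exists z.
  by exists (fun=> 0).
pose F := fix F n := match n with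
  | 0%N => ((fun=> 0) : nat -> R, z0)
  | m.+1 => ((F m).2, f (m, F m)) end.
have FP n : interlaced_roots n (F n).
  by elim: n => [//|n IH]; exact: (fP (n, F n)).
by exists (fun n => (F n).1) => n; have := FP n; rewrite [F n]surjective_pairing.
Qed.

End JacobiSolutions.

(** * The current inequality *)

(** The strict tangent inequality for log sin at [m], exponentiated. The quotient [f] of the two
    sides has a derivative with the sign of [sin (m - s)], so its only maximum is at [m]. *)
Lemma sin_lt_tangent (R : realType) (m t : R) : 0 < m < pi -> 0 < t < pi ->
  t != m -> sin t < sin m * expR ((t - m) * (cos m / sin m)).
Proof.
move=> mI tI tm; have sm := sin_gt0_pi mI.
pose c := cos m / sin m.
pose f (s : R) := sin s * expR (- ((s - m) * c)).
pose df (s : R) := expR (- ((s - m) * c)) * (sin (m - s) / sin m).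
have fD (s : R) : is_derive s (1 : R) f (df s).
  have h1 : is_derive s (1 : R) (fun s : R => - ((s - m) * c)) (- c).
    by apply: is_derive_eq; rewrite /GRing.scale /=; ring.
  have h2 : is_derive s (1 : R) (fun s : R => expR (- ((s - m) * c)))
      (expR (- ((s - m) * c)) * - c).
    by apply: is_derive_eq; rewrite /GRing.scale /=; ring.
  apply: is_derive_eq; rewrite /df sinB /GRing.scale /= /c.
  by field; rewrite gt_eqF.
have fcont x y : {within `[x, y], continuous f}.
  apply: continuous_subspaceT => s.
  by apply/differentiable_continuous/derivable1_diffP; apply: ex_derive.
have main : f t < f m.
  have [/andP[m0 mpi] /andP[t0 tpi]] := (mI, tI).
  have [tltm|mltt|e] := ltgtP t m; last by rewrite e eqxx in tm.
  - have [s] := @MVT R f df t m tltm (fun s _ => fD s) (fcont _ _).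
    rewrite in_itv /= => /andP[ts sm'] e.
    rewrite -subr_gt0 e mulr_gt0 ?subr_gt0// mulr_gt0 ?expR_gt0// divr_gt0//.
    by apply: sin_gt0_pi; apply/andP; split; lra.
  - have [s] := @MVT R f df m t mltt (fun s _ => fD s) (fcont _ _).
    rewrite in_itv /= => /andP[ts sm'] e.
    rewrite -subr_lt0 e pmulr_llt0 ?subr_gt0// pmulr_rlt0 ?expR_gt0//.
    rewrite pmulr_llt0 ?invr_gt0// -opprB sinN oppr_lt0.
    by apply: sin_gt0_pi; apply/andP; split; lra.
move: main; rewrite /f subrr mul0r oppr0 expR0 mulr1 expRN.
by rewrite ltr_pdivrMr ?expR_gt0.
Qed.

Lemma ltr_prod_strict (R : realDomainType) (n : nat) (F G : nat -> R) (k : nat) :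
  (forall i, (i < n)%N -> 0 < F i <= G i) -> (k < n)%N -> F k < G k ->
  \prod_(i < n) F i < \prod_(i < n) G i.
Proof.
move=> FG kn Fk; rewrite (bigD1 (Ordinal kn))//= [ltRHS](bigD1 (Ordinal kn))//=.
have le : \prod_(i < n | i != Ordinal kn) F i <= \prod_(i < n | i != Ordinal kn) G i.
  by apply: ler_prod => i _; have /andP[/ltW -> ->] := FG _ (ltn_ord i).
apply: (lt_le_trans (y := G k * \prod_(i < n | i != Ordinal kn) F i)).
  by rewrite ltr_pM2r// prodr_gt0// => i _; have /andP[] := FG _ (ltn_ord i).
rewrite ler_wpM2l// ltW//; have /andP[h _] := FG _ kn; exact: lt_trans h Fk.
Qed.

(** The tangents at the mean [m] are multiplied: their exponents add up to 0, so only [sin m ^+ n]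
    remains. *)
Lemma prod_sin_le (R : realType) (n : nat) (phi : nat -> R) (m : R) :
  (forall i, (i < n)%N -> 0 < phi i < pi) -> 0 < m < pi ->
  \sum_(i < n) phi i = n%:R * m ->
  \prod_(i < n) sin (phi i) <= sin m ^+ n /\
  (\prod_(i < n) sin (phi i) = sin m ^+ n ->
     forall i, (i < n)%N -> phi i = m).
Proof.
move=> phiI mI phiS; pose G i := sin m * expR ((phi i - m) * (cos m / sin m)).
have GE : \prod_(i < n) G i = sin m ^+ n.
  rewrite big_split /= prodr_const card_ord -expR_sum -mulr_suml sumrB.
  by rewrite phiS sumr_const card_ord -[m *+ n]mulr_natl subrr mul0r expR0 mulr1.
have FG i : (i < n)%N -> 0 < sin (phi i) <= G i.
  move=> ni; rewrite sin_gt0_pi ?phiI//=.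
  have [e|ne] := eqVneq (phi i) m; last by rewrite ltW// sin_lt_tangent ?phiI.
  by rewrite /G e subrr mul0r expR0 mulr1.
split.
  rewrite -GE; apply: ler_prod => i _.
  by have /andP[/ltW -> ->] := FG _ (ltn_ord i).
move=> e i ni; apply/eqP/negPn/negP => ne.
have := ltr_prod_strict FG ni (sin_lt_tangent mI (phiI _ ni) ne).
by rewrite GE e ltxx.
Qed.

Lemma current_bound (R : realType) (q : nat) (al r phi : nat -> R) (J A : R) :
  (0 < q)%N -> 0 < A -> A ^+ q = \prod_(n < q) al n ->
  (forall n, 0 < r n) -> r q = r 0%N ->
  (forall n, 0 < phi n < pi) ->
  (forall n, (n < q)%N -> al n * (r n * r n.+1 * sin (phi n)) = J) -> 0 < J ->
  let m := (\sum_(n < q) phi n) / q%:R in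
  let B := A * ((\sum_(n < q) r n ^+ 2) / q%:R * sin m) in
  J <= B /\
  (J = B -> forall n, (n < q)%N -> r n = r 0%N /\ phi n = phi 0%N).
Proof.
move=> q0 A0 Aq r0 rq phiI Jn J0 m B.
have qR : 0 < q%:R :> R by rewrite ltr0n.
have mI : 0 < m < pi.
  rewrite divr_gt0//=; last first.
    case: q q0 {Aq rq Jn m B qR} => // q _; rewrite big_ord_recl ltr_pwDl//.
      by have /andP[] := phiI 0%N.
    by rewrite sumr_ge0// => i _; have /andP[/ltW] := phiI (lift ord0 i).
  rewrite ltr_pdivrMr// -[ltRHS](_ : \sum_(i < q) pi = _); last first.
    by rewrite sumr_const card_ord mulr_natr.
  apply: ltr_sum => [|i _]; last by have /andP[] := phiI i.
  by apply/hasP; exists (Ordinal q0); rewrite ?mem_index_enum.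
have phiS : \sum_(n < q) phi n = q%:R * m by rewrite mulrC divfK// gt_eqF.
have [sle seq] := prod_sin_le (fun i (_ : (i < q)%N) => phiI i) mI phiS.
pose S := (\sum_(n < q) r n ^+ 2) / q%:R.
have [rle req] := @leif_AGM R 'I_q 'I_q (fun n => r n ^+ 2) (fun n _ => sqr_ge0 (r n)).
have cq : #|'I_q| = q by rewrite card_ord.
rewrite /= cq -/S in rle req.
(* Periodicity of [r] turns the product of the [r n * r n.+1] into that of the squares; the claim
   can then be checked on q-th powers. *)
have rS : \prod_(n < q) r n.+1 = \prod_(n < q) r n.
  apply: (mulfI (lt0r_neq0 (r0 0%N))).
  by rewrite -[LHS](big_ord_recl q (fun n => r n)) big_ord_recr /= rq mulrC.
have JE : J ^+ q = A ^+ q * (\prod_(n < q) r n ^+ 2 * \prod_(n < q) sin (phi n)).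
  rewrite Aq -{1}(card_ord q) -prodr_const.
  rewrite (eq_bigr (fun n : 'I_q => al n * (r n * r n.+1 * sin (phi n)))).
    by rewrite !big_split /= rS.
  by move=> n _; rewrite Jn.
have sm0 : 0 < sin m by exact: sin_gt0_pi.
have rp0 : 0 < \prod_(n < q) r n ^+ 2 by apply: prodr_gt0 => i _; rewrite exprn_gt0.
have sp0 : 0 < \prod_(n < q) sin (phi n).
  by apply: prodr_gt0 => i _; apply: sin_gt0_pi.
have S0 : 0 <= S by rewrite divr_ge0 ?ler0n// sumr_ge0// => i _; exact: sqr_ge0.
have B0 : 0 <= B by rewrite mulr_ge0 ?(ltW A0)// mulr_ge0// ltW.
have BE : B ^+ q = A ^+ q * (S ^+ q * sin m ^+ q) by rewrite /B -/S !exprMn.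
split.
  rewrite -(@ler_pXn2r _ q)// ?nnegrE ?(ltW J0)// JE BE.
  by rewrite ler_pM2l ?exprn_gt0// ler_pM// ltW.
move=> JB.
have /(mulfI (lt0r_neq0 (exprn_gt0 q A0))) e :
    A ^+ q * (\prod_(n < q) r n ^+ 2 * \prod_(n < q) sin (phi n)) =
    A ^+ q * (S ^+ q * sin m ^+ q) by rewrite -JE -BE JB.
(* Both factors are bounded by their counterparts and the products agree, so each bound is an
   equality; the equality cases of AM-GM and of log sin then apply separately. *)
have Sq0 : 0 < S ^+ q by exact: lt_le_trans rp0 rle.
have er : \prod_(n < q) r n ^+ 2 = S ^+ q.
  apply/eqP; rewrite eq_le rle /= -(ler_pM2r (exprn_gt0 q sm0)) -e.
  by rewrite ler_pM2l.
have es : \prod_(n < q) sin (phi n) = sin m ^+ q.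
  by apply: (mulfI (lt0r_neq0 Sq0)); rewrite -e er.
have phiE := seq es.
move: req; rewrite er eqxx => /esym /forallP req n nq; split; last first.
  by rewrite !phiE.
have := req (Ordinal q0) => /forallP /(_ (Ordinal nq)) /eqP /= h.
by apply/eqP; rewrite -(@eqrXn2 _ 2) ?ltW//; apply/eqP.
Qed.

(* Turning a vector counterclockwise to the next one adds to its argument the
   angle in (0, pi) between the two. *)
Lemma polar_lift (R : realType) (X Y : nat -> R) : X 0%N = 1 -> Y 0%N = 0 ->
  (forall n, 0 < X n * Y n.+1 - X n.+1 * Y n) ->
  exists r phi : nat -> R, forall n (t := \sum_(i < n) phi i),
    [/\ 0 < r n, 0 < phi n < pi, X n = r n * cos t & Y n = r n * sin t].
Proof.
move=> X0 Y0 cross0.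
pose r n := Num.sqrt (X n ^+ 2 + Y n ^+ 2).
pose dot n := X n * X n.+1 + Y n * Y n.+1.
pose cross n := X n * Y n.+1 - X n.+1 * Y n.
have s0 n : 0 < X n ^+ 2 + Y n ^+ 2.
  rewrite lt_def addr_ge0 ?sqr_ge0// andbT paddr_eq0 ?sqr_ge0// !sqrf_eq0.
  apply/negP => /andP[/eqP x0 /eqP y0]; have := cross0 n.
  by rewrite x0 y0 mulr0 mul0r subrr ltxx.
have r0 n : 0 < r n by rewrite sqrtr_gt0.
have r2 n : r n ^+ 2 = X n ^+ 2 + Y n ^+ 2 by rewrite sqr_sqrtr// ltW.
have rr0 n : r n * r n.+1 != 0 by rewrite mulf_neq0// gt_eqF.
have dc n : (dot n / (r n * r n.+1)) ^+ 2 + (cross n / (r n * r n.+1)) ^+ 2 = 1.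
  rewrite !expr_div_n -mulrDl exprMn !r2.
  have -> : dot n ^+ 2 + cross n ^+ 2 =
      (X n ^+ 2 + Y n ^+ 2) * (X n.+1 ^+ 2 + Y n.+1 ^+ 2).
    by rewrite /dot /cross; ring.
  by rewrite divff// mulf_neq0// gt_eqF.
have c0 n : 0 < cross n / (r n * r n.+1) by rewrite divr_gt0 ?mulr_gt0//; exact: cross0.
(* The cosine of the angle is the normalized scalar product; positivity of [cross n] makes the sine
   positive and keeps the angle strictly between 0 and pi. *)
pose phi n := acos (dot n / (r n * r n.+1)).
have dI n : -1 < dot n / (r n * r n.+1) < 1.
  rewrite -ltr_norml -(@ltr_pXn2r _ 2)// ?nnegrE// expr1n real_normK ?num_real//.
  by rewrite -(dc n) ltrDl exprn_gt0.
have dI' n : -1 <= dot n / (r n * r n.+1) <= 1 by have /andP[/ltW -> /ltW ->] := dI n.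
have phiI n : 0 < phi n < pi.
  have /andP[h1 h2] := dI n.
  by rewrite acos_gt0 ?acos_ltpi// ?h1 ?h2 ?(ltW h1) ?(ltW h2).
have cphi n : cos (phi n) = dot n / (r n * r n.+1) by rewrite acosK// in_itv /= dI'.
have sphi n : sin (phi n) = cross n / (r n * r n.+1).
  rewrite sin_acos// -(dc n) addrC addKr sqrtr_sqr gtr0_norm//.
exists r, phi; elim=> [|n [_ _ Xn Yn]] t.
  rewrite /t big_ord0 cos0 sin0 mulr1 mulr0 phiI /r X0 Y0.
  by rewrite expr1n expr0n /= addr0 sqrtr1.
rewrite /t big_ord_recr /= phiI r0 cosD sinD cphi sphi.
have rn := lt0r_neq0 (r0 n); have rn1 := lt0r_neq0 (r0 n.+1).
split => //.
- apply: (mulfI (mulf_neq0 rn rn)).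
  transitivity (X n * dot n - Y n * cross n).
    by rewrite -expr2 r2 /dot /cross; ring.
  by rewrite {1}Xn {1}Yn; field; rewrite rn rn1.
- apply: (mulfI (mulf_neq0 rn rn)).
  transitivity (Y n * dot n + X n * cross n).
    by rewrite -expr2 r2 /dot /cross; ring.
  by rewrite {1}Xn {1}Yn; field; rewrite rn rn1.
Qed.

Lemma sin_sign (R : realType) (k : nat) (t : R) :
  k%:R * pi < t < k.+1%:R * pi -> 0 < (-1) ^+ k * sin t.
Proof.
move=> /andP[kt tk]; rewrite -(alternatingn (@sinDpi R)) -[t](subrK (k%:R * pi)).
have -> : t - k%:R * pi + k%:R * pi + pi *+ k = (t - k%:R * pi) + (pi *+ 2) *+ k.
  by rewrite -[pi *+ k]mulr_natl -[pi *+ 2 *+ k]mulr_natl; ring.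
rewrite (periodicn (@sinD2pi R)); apply: sin_gt0_pi.
by move: tk; rewrite -natr1 mulrDl mul1r => tk; apply/andP; split; lra.
Qed.

(** * Floquet solutions inside the bands *)

Section Floquet.
Variables (R : realType) (al b : nat -> R) (N : nat).
Hypothesis al_gt0 : forall n, 0 < al n.
Hypothesis al_per : al N.+1 = al 0.

Let u := dirichlet_sol al b.
Let v := neumann_sol al b.

Lemma deriv_wronskian (p0 p1 q0 q1 : {poly R}) n x :
  p0^`() = 0 -> p1^`() = 0 ->
  let s := jacobi_sol al b p0 p1 in
  let t := jacobi_sol al b q0 q1 in
  al n * ((s n.+1)^`().[x] * (t n).[x] - (s n)^`().[x] * (t n.+1).[x]) =
  \sum_(k < n) (s k.+1).[x] * (t k.+1).[x].
Proof.
move=> dp0 dp1 s t; elim: n => [|n IH].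
  by rewrite big_ord0 /s /= dp0 dp1 !horner0 !mul0r subrr mulr0.
rewrite big_ord_recr /= -IH mulrBr mulrA /s deriv_jacobi_solE//.
have := jacobi_solE b al_gt0 q0 q1 n x; rewrite -/t => e.
by rewrite [al n.+1 * (_ * (t n.+2).[x])]mulrCA e -/s; ring.
Qed.

Lemma monodromy_det x :
  (u N.+2).[x] * (v N.+1).[x] - (v N.+2).[x] * (u N.+1).[x] = 1.
Proof.
have := jacobi_wronskian b al_gt0 N.+1 x; rewrite al_per -/u -/v => e.
by apply: (mulfI (lt0r_neq0 (al_gt0 0))); rewrite e mulr1.
Qed.

(** The trace of the monodromy matrix for the period [N.+1], whose rows are the values of [u] and
    [v] at [N.+2] and at [N.+1]. *)
Definition disc_poly := u N.+2 + v N.+1.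

Let D := disc_poly.

Lemma disc_poly_size : size D = N.+2.
Proof.
have [_ s1 _] := dirichlet_sol_size b al_gt0 N.+1.
have /andP[_ s2] := neumann_sol_size al b N.
by rewrite /D /disc_poly size_polyDl s1.
Qed.

Lemma disc_poly_lead : 0 < lead_coef D.
Proof.
have [_ s1 l1] := dirichlet_sol_size b al_gt0 N.+1.
have /andP[_ s2] := neumann_sol_size al b N.
by rewrite /D /disc_poly lead_coefDl// s1.
Qed.

(** The four Green identities over one period are linear equations for the derivatives of the
    monodromy entries; determinant 1 lets Cramer's rule solve them without denominators. *)
Lemma deriv_disc_poly x :
  al 0 * D^`().[x] =
    - (v N.+2).[x] * \sum_(k < N.+1) (u k.+1).[x] * (u k.+1).[x]
    + ((u N.+2).[x] - (v N.+1).[x]) * \sum_(k < N.+1) (u k.+1).[x] * (v k.+1).[x]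
    + (u N.+1).[x] * \sum_(k < N.+1) (v k.+1).[x] * (v k.+1).[x].
Proof.
have d0 : (0 : {poly R})^`() = 0 by rewrite deriv0.
have d1 : (1 : {poly R})^`() = 0 by rewrite derivC.
have uu := deriv_wronskian 0 1 N.+1 x d0 d1.
have uv := deriv_wronskian 1 0 N.+1 x d0 d1.
have vu := deriv_wronskian 0 1 N.+1 x d1 d0.
have vv := deriv_wronskian 1 0 N.+1 x d1 d0.
cbv zeta in uu, uv, vu, vv.
rewrite -/(dirichlet_sol _ _) -/(neumann_sol _ _) -/u -/v al_per in uu uv vu vv.
have {}vu : \sum_(k < N.+1) (u k.+1).[x] * (v k.+1).[x] =
    al 0 * ((v N.+2)^`().[x] * (u N.+1).[x] - (v N.+1)^`().[x] * (u N.+2).[x]).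
  by rewrite vu; apply: eq_bigr => i _; rewrite mulrC.
have det := monodromy_det x.
have uE : al 0 * (u N.+2)^`().[x] =
    - (v N.+2).[x] * \sum_(k < N.+1) (u k.+1).[x] * (u k.+1).[x]
    + (u N.+2).[x] * \sum_(k < N.+1) (u k.+1).[x] * (v k.+1).[x].
  by rewrite -uu -uv -[LHS]mulr1 -[in LHS]det; ring.
have vE : al 0 * (v N.+1)^`().[x] =
    - (v N.+1).[x] * \sum_(k < N.+1) (u k.+1).[x] * (v k.+1).[x]
    + (u N.+1).[x] * \sum_(k < N.+1) (v k.+1).[x] * (v k.+1).[x].
  by rewrite vu -vv -[LHS]mulr1 -[in LHS]det; ring.
by rewrite /D /disc_poly derivD hornerD mulrDr uE vE; ring.
Qed.

(** If [u N.+1] vanished, the monodromy would be triangular with reciprocal diagonal entries s and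
    t, and (s + t)^2 >= 4 s t = 4. *)
Lemma dirichlet_sol_neq0 x : `|D.[x]| < 2 -> (u N.+1).[x] != 0.
Proof.
move=> Dx; apply/eqP => u0; have := monodromy_det x; rewrite u0 mulr0 subr0 => e.
move: Dx; rewrite ltr_norml /D /disc_poly hornerD.
move: e; set s := (u _).[x]; set t := (v _).[x] => e /andP[h1 h2].
have : 0 <= (s - t) ^+ 2 by exact: sqr_ge0.
have -> : (s - t) ^+ 2 = (s + t) ^+ 2 - 4 * (s * t) by ring.
rewrite e; nra.
Qed.

(* The Floquet solution psi_n = r_n e^(i t_n) at an energy inside a band,
   normalized by psi_0 = 1, where t_n = phi_0 + ... + phi_(n-1) and J is its
   current a(n) Im(conj(psi_n) psi_(n+1)), which does not depend on n. *)
Record floquet_polar (x : R) (r phi : nat -> R) (J : R) : Prop := FloquetPolar {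
  fp_r_gt0 : forall n, 0 < r n;
  fp_phi : forall n, 0 < phi n < pi;
  fp_J_gt0 : 0 < J;
  fp_r0 : r 0%N = 1;
  fp_rN : r N.+1 = 1;
  fp_current : forall n, al n * (r n * r n.+1 * sin (phi n)) = J;
  fp_disc : D.[x] = 2 * cos (\sum_(i < N.+1) phi i);
  fp_deriv : D^`().[x] * J =
    sin (\sum_(i < N.+1) phi i) * \sum_(n < N.+1) r n ^+ 2;
  fp_dirichlet : forall n,
    J * (u n).[x] = al 0 * (r n * sin (\sum_(i < n) phi i));
  fp_rec : forall n, (x - b n.+1) * r n.+1 ^+ 2 =
    al n.+1 * (r n.+1 * r n.+2 * cos (phi n.+1)) + al n * (r n * r n.+1 * cos (phi n));
  fp_per : r N.+1 * r N.+2 * cos (phi N.+1) = r 0%N * r 1%N * cos (phi 0%N);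
  fp_r1 : r 1%N ^+ 2 * (u N.+1).[x] = - (v N.+2).[x];
  fp_cos0 : 2 * (r 1%N * cos (phi 0%N)) * (u N.+1).[x] = (u N.+2).[x] - (v N.+1).[x]
}.

(** The solution is psi = z u + v, where z = psi_1 = xi + i kap is the root in the upper half plane
    of u_q z^2 - (u_(q+1) - v_q) z - v_(q+1) = 0 with q = [N.+1]. This is the condition that (psi_1,
    psi_0) be an eigenvector of the monodromy; choosing the upper root makes the current
    positive. *)
Lemma floquet_polarP x : `|D.[x]| < 2 -> exists r phi J, floquet_polar x r phi J.
Proof.
move=> Dx; have u0 := dirichlet_sol_neq0 Dx; have det := monodromy_det x.
(* [s] is the modulus of the imaginary part of the Floquet multiplier, whose real part is Delta /
   2. *)
pose s := Num.sqrt (1 - (D.[x] / 2) ^+ 2).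
have D2 : 0 < 1 - (D.[x] / 2) ^+ 2.
  by move: Dx; rewrite ltr_norml => /andP[h1 h2]; nra.
have s0 : 0 < s by rewrite sqrtr_gt0.
have s2 : s ^+ 2 = 1 - (D.[x] / 2) ^+ 2 by rewrite sqr_sqrtr// ltW.
pose kap := s / `|(u N.+1).[x]|.
have kap0 : 0 < kap by rewrite divr_gt0// normr_gt0.
have ku : kap ^+ 2 * (u N.+1).[x] ^+ 2 = s ^+ 2.
  by rewrite /kap expr_div_n real_normK ?num_real// divfK// expf_neq0.
pose xi := ((u N.+2).[x] - (v N.+1).[x]) / (2 * (u N.+1).[x]).
have xiu : xi * (u N.+1).[x] = ((u N.+2).[x] - (v N.+1).[x]) / 2.
  by rewrite /xi; field.
have DE : D.[x] = (u N.+2).[x] + (v N.+1).[x] by rewrite hornerD.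
have modu : (xi ^+ 2 + kap ^+ 2) * (u N.+1).[x] = - (v N.+2).[x].
  apply: (mulIf u0); transitivity ((xi * (u N.+1).[x]) ^+ 2 + kap ^+ 2 * (u N.+1).[x] ^+ 2).
    by ring.
  by rewrite xiu ku s2 DE -[X in _ + (X - _)]det; field.
(* Real and imaginary parts of psi_n. *)
pose X n := (u n).[x] * xi + (v n).[x].
pose Y n := kap * (u n).[x].
have X0 : X 0%N = 1 by rewrite /X /u /v /= horner0 mul0r add0r hornerC.
have Y0 : Y 0%N = 0 by rewrite /Y /u /= horner0 mulr0.
have X1 : X 1%N = xi by rewrite /X /u /v /= horner0 hornerC mul1r addr0.
have Y1 : Y 1%N = kap by rewrite /Y /u /= hornerC mulr1.
have cr n : al n * (X n * Y n.+1 - X n.+1 * Y n) = al 0 * kap.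
  have := jacobi_wronskian b al_gt0 n x; rewrite -/u -/v => <-.
  by rewrite /X /Y; ring.
have cr0 n : 0 < X n * Y n.+1 - X n.+1 * Y n.
  by rewrite -(pmulr_rgt0 _ (al_gt0 n)) cr mulr_gt0.
have [r [phi P]] := polar_lift X0 Y0 cr0.
have r0 n : 0 < r n by have [] := P n.
have phiI n : 0 < phi n < pi by have [] := P n.
have XE n : X n = r n * cos (\sum_(i < n) phi i) by have [] := P n.
have YE n : Y n = r n * sin (\sum_(i < n) phi i) by have [] := P n.
have r2 n : r n ^+ 2 = X n ^+ 2 + Y n ^+ 2.
  by rewrite XE YE !exprMn -mulrDr cos2Dsin2 mulr1.
have phiE n : phi n = \sum_(i < n.+1) phi i - \sum_(i < n) phi i.
  by rewrite big_ord_recr /= addrAC subrr add0r.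
have crE n : X n * Y n.+1 - X n.+1 * Y n = r n * r n.+1 * sin (phi n).
  by rewrite !XE !YE phiE sinB; ring.
have dotE n : X n * X n.+1 + Y n * Y n.+1 = r n * r n.+1 * cos (phi n).
  by rewrite !XE !YE phiE cosB; ring.
have XN : X N.+1 = D.[x] / 2 by rewrite /X mulrC xiu DE; field.
have YN2 : Y N.+1 ^+ 2 = s ^+ 2 by rewrite /Y exprMn ku.
have sqr1 n : X n ^+ 2 + Y n ^+ 2 = 1 -> r n = 1.
  rewrite -r2 => /eqP; rewrite sqrf_eq1 => /orP[/eqP//|/eqP e].
  by have := r0 n; rewrite e oppr_gt0 ltr10.
have rN : r N.+1 = 1 by apply: sqr1; rewrite YN2 XN s2 addrC subrK.
have rr0 : r 0%N = 1 by apply: sqr1; rewrite X0 Y0 expr1n expr0n addr0.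
have recX n : al n.+1 * X n.+2 = (x - b n.+1) * X n.+1 - al n * X n.
  have := jacobi_solE b al_gt0 0 1 n x; have := jacobi_solE b al_gt0 1 0 n x.
  rewrite -[jacobi_sol _ _ 0 _]/u -[jacobi_sol _ _ 1 _]/v => ev eu.
  by rewrite /X mulrDr mulrA eu ev; ring.
have recY n : al n.+1 * Y n.+2 = (x - b n.+1) * Y n.+1 - al n * Y n.
  have := jacobi_solE b al_gt0 0 1 n x; rewrite -[jacobi_sol _ _ 0 _]/u => eu.
  by rewrite /Y mulrCA eu; ring.
exists r, phi; exists (al 0 * kap); apply: FloquetPolar => //.
- exact: mulr_gt0.
- by move=> n; rewrite -crE cr.
- by have := XE N.+1; rewrite rN mul1r XN => <-; field.
- transitivity (kap * (al 0 * D^`().[x])); first by ring.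
  rewrite deriv_disc_poly.
  have -> : sin (\sum_(i < N.+1) phi i) = kap * (u N.+1).[x].
    by have := YE N.+1; rewrite rN mul1r => <-.
  (* The sum is shifted by one index to match the range in [deriv_disc_poly]. Expanding |psi_k|^2
     then gives the quadratic form found there, divided by [(u N.+1).[x]]. *)
  have -> : \sum_(n < N.+1) r n ^+ 2 = \sum_(n < N.+1) r n.+1 ^+ 2.
    by rewrite big_ord_recl [RHS]big_ord_recr /= rN rr0 addrC.
  have -> : \sum_(n < N.+1) r n.+1 ^+ 2 =
      (xi ^+ 2 + kap ^+ 2) * \sum_(k < N.+1) (u k.+1).[x] * (u k.+1).[x] +
      2 * xi * \sum_(k < N.+1) (u k.+1).[x] * (v k.+1).[x] +
      \sum_(k < N.+1) (v k.+1).[x] * (v k.+1).[x].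
    rewrite !mulr_sumr -!big_split /=; apply: eq_bigr => k _.
    by rewrite r2 /X /Y; ring.
  rewrite -[kap * _ * _]mulrA; congr (_ * _); rewrite -modu.
  have -> : (u N.+2).[x] - (v N.+1).[x] = 2 * (xi * (u N.+1).[x]).
    by rewrite xiu; field.
  by ring.
- by move=> n; rewrite -YE /Y; ring.
- move=> n; rewrite -!dotE r2.
  transitivity (X n.+1 * (al n.+1 * X n.+2) + Y n.+1 * (al n.+1 * Y n.+2) +
      al n * (X n * X n.+1 + Y n * Y n.+1)).
    by rewrite recX recY; ring.
  by ring.
- rewrite -!dotE X0 Y0 X1 mul0r addr0 mul1r.
  (* With the next identity this says psi_(q+1) = psi_1 psi_q: one period multiplies psi by psi_q, a
     number of modulus 1. *)
  have -> : X N.+2 = xi * X N.+1 - kap * Y N.+1.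
    apply: (mulIf u0); rewrite /X /Y.
    have e1 : xi * (xi * (u N.+1).[x]) + kap * (kap * (u N.+1).[x]) = - (v N.+2).[x].
      by rewrite -modu; ring.
    transitivity (xi * (u N.+1).[x] * ((u N.+2).[x] - (v N.+1).[x])
       + (v N.+2).[x] * (u N.+1).[x] + xi * (u N.+1).[x] * (v N.+1).[x]).
      by ring.
    transitivity (xi * (u N.+1).[x] * ((xi * (u N.+1).[x]) + (v N.+1).[x])
       - kap ^+ 2 * (u N.+1).[x] ^+ 2); last by ring.
    by rewrite ku s2 xiu DE -[X in _ = _ - (X - _)]det; field.
  have -> : Y N.+2 = kap * X N.+1 + xi * Y N.+1.
    transitivity (kap * (2 * (xi * (u N.+1).[x]) + (v N.+1).[x])).
      by rewrite xiu /Y; field.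
    by rewrite /X /Y; ring.
  transitivity (xi * (X N.+1 ^+ 2 + Y N.+1 ^+ 2)); first by ring.
  by rewrite -r2 rN expr1n mulr1.
- by rewrite r2 X1 Y1.
- have := XE 1%N; rewrite X1 big_ord1 => <-.
  by rewrite -mulrA xiu; field.
Qed.

End Floquet.

(** * Sturm oscillation and the position of the bands *)

Section Slots.
Variables (R : realType) (al b : nat -> R) (N : nat) (nu : nat -> nat -> R).
Hypothesis al_gt0 : forall n, 0 < al n.
Hypothesis al_per : al N.+1 = al 0.
Hypothesis nuP : forall n, interlaced_roots al b n (nu n, nu n.+1).

Let u := dirichlet_sol al b.
Let v := neumann_sol al b.
Let D := disc_poly al b N.

Lemma dirichlet_roots_dec n i : (i.+1 < n)%N -> nu n i.+1 < nu n i.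
Proof.
case: n => // n; rewrite ltnS => ni; have [_ _ /(_ _ ni) /andP[]] := nuP n.
exact: lt_trans.
Qed.

(* Sturm oscillation: the phase t_(n+1) of the Floquet solution counts the
   roots of u_(n+1) to the right of x, because psi_n and psi_(n+1) are less
   than half a turn apart and the roots of u_n and u_(n+1) interlace. *)
Lemma sturm_phase x r phi J n k : floquet_polar al b N x r phi J ->
  (k <= n)%N -> (forall i, (i < k)%N -> x < nu n i) ->
  (forall i, (k <= i < n)%N -> nu n i <= x) ->
  k%:R * pi < \sum_(i < n.+1) phi i <= k.+1%:R * pi.
Proof.
move=> P; have phiI := fp_phi P; have p0 := pi_gt0 R.
elim: n k => [|n IH] k kn above below.
  have -> : k = 0%N by lia.
  rewrite big_ord1 mul0r mul1r; have /andP[-> /ltW -> //] := phiI 0%N.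
have [uR uR' int] := nuP n; rewrite /= in uR uR' int.
have /andP[ph0 phpi] := phiI n.+1.
have [_ _ l1] := dirichlet_sol_size b al_gt0 n.+1.
have usgn : 0 <= (-1) ^+ k * (u n.+2).[x].
  exact: roots_of_degree_sign uR' l1 kn above below.
have uS : J * (u n.+2).[x] = al 0 * (r n.+2 * sin (\sum_(i < n.+2) phi i)).
  exact: fp_dirichlet P n.+2.
have ssgn : 0 <= (-1) ^+ k * sin (\sum_(i < n.+2) phi i).
  have := mulr_ge0 (ltW (fp_J_gt0 P)) usgn; rewrite mulrCA uS.
  have -> : (-1) ^+ k * (al 0 * (r n.+2 * sin (\sum_(i < n.+2) phi i))) =
    (al 0 * r n.+2) * ((-1) ^+ k * sin (\sum_(i < n.+2) phi i)) by ring.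
  by rewrite pmulr_rge0// mulr_gt0//; exact: fp_r_gt0 P _.
have tE : \sum_(i < n.+2) phi i = \sum_(i < n.+1) phi i + phi n.+1.
  by rewrite big_ord_recr.
set t := \sum_(i < n.+2) phi i in ssgn uS tE *.
set t' := \sum_(i < n.+1) phi i in IH tE.
have aboveS i : (i.+1 < k)%N -> x < nu n i.
  move=> ik; have /andP[h _] := int i (ltac:(lia)).
  exact: lt_trans (above _ ik) h.
have belowS i : (k <= i < n)%N -> nu n i <= x.
  move=> /andP[ki i_n]; have /andP[_ h] := int i i_n.
  by apply: le_trans (ltW h) _; apply: below; lia.
(* The test asks whether [u n.+1] has [k] roots to the right of [x], or [k - 1]. In the first case
   only the upper bound depends on the sign of [u n.+2], in the second only the lower bound. *)
have [/andP[kn' ck]|ck] := boolP ((k <= n)%N && ((k == 0%N) || (x < nu n k.-1))).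
  have /andP[kt tk] : k%:R * pi < t' <= k.+1%:R * pi.
    apply: IH => // i ik; have [/aboveS//|] := ltnP i.+1 k => ki.
    by have e : i = k.-1 by [lia]; move: ck; rewrite -e; case: eqP => // ?; lia.
  apply/andP; split; first by rewrite tE; lra.
  rewrite leNgt; apply/negP => tk'.
  have := @sin_sign _ k.+1 t; rewrite tk' /= exprS mulN1r mulNr oppr_gt0 => h.
  have {}h : (-1) ^+ k * sin t < 0.
    apply: h; rewrite tE; move: tk ph0 phpi; rewrite -![_.+2%:R]natr1; lra.
  by move: ssgn; rewrite leNgt h.
case: k => [|k] in kn above below usgn ssgn aboveS belowS ck *.
  by move: ck; rewrite leq0n eqxx.
rewrite /= in ck.
have /andP[kt tk] : k%:R * pi < t' <= k.+1%:R * pi.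
  apply: IH => [|i ik|i /andP[ki i_n]]; first lia.
    by apply: aboveS; lia.
  have [e|ne] := eqVneq i k; last by apply: belowS; lia.
  by rewrite leNgt; apply: contra ck; rewrite e => ->; rewrite andbT; lia.
apply/andP; split; last first.
  by rewrite tE; move: tk ph0 phpi; rewrite -[k.+2%:R]natr1; lra.
rewrite ltNge; apply/negP => tk'.
have s0 : sin t = 0.
  move: tk'; rewrite le_eqVlt => /orP[/eqP ->|tk'].
    by rewrite mulr_natl -[pi *+ _]add0r alternatingn ?sin0 ?mulr0//; exact: sinDpi.
  have := @sin_sign _ k t; rewrite tk' andbT => h.
  have {}h : 0 < (-1) ^+ k * sin t by apply: h; rewrite tE; lra.
  by move: ssgn; rewrite exprS mulN1r mulNr oppr_ge0 leNgt h.
(* The phase can still be the excluded multiple of pi itself. Then [x] is a root of [u n.+2], and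
   the interlacing puts one more root of [u n.+1] to its right than this case allows. *)
have ux : (u n.+2).[x] = 0.
  move: uS; rewrite s0 !mulr0 => /eqP; rewrite mulf_eq0 (gt_eqF (fp_J_gt0 P)).
  by move=> /eqP.
have u0 : u n.+2 != 0 by rewrite -lead_coef_eq0 gt_eqF.
have [i i_n xE] := roots_of_degree_root uR' u0 ux.
have ki : (k < i)%N by rewrite ltnNge; apply/negP => ik; have := above i ik; rewrite xE ltxx.
have kn1 : (k < n)%N by exact: leq_trans ki i_n.
have /negP : ~~ (x < nu n k) by apply: contra ck => ->; rewrite andbT.
apply; have /andP[h _] := int k kn1.
apply: le_lt_trans h; rewrite xE; have [->//|ne] := eqVneq i k.+1.
apply/ltW/(decreasing_lt (N := n.+1)) => [j|]; first exact: dirichlet_roots_dec.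
by rewrite i_n andbT ltn_neqAle eq_sym ne.
Qed.

(** The intervals left after removing the [N] roots of [u N.+1], numbered from 0 starting at the
    right. They are open, so a root lies in none of them. *)
Definition slot (i : nat) (x : R) :=
  (forall k, (k < i)%N -> x < nu N k) /\
  (forall k, (i <= k < N)%N -> nu N k < x).

Lemma slot_inj i j x : (i <= N)%N -> (j <= N)%N -> slot i x -> slot j x -> i = j.
Proof.
have aux k l : (k < l)%N -> (l <= N)%N -> slot k x -> slot l x -> False.
  move=> kl lN [_ /(_ k) h1] [/(_ k kl) h2 _].
  have : nu N k < x by apply: h1; lia.
  by rewrite ltNge ltW.
move=> iN jN si sj; case: (ltngtP i j) => // ij.
  by case: (aux _ _ ij jN si sj).
by case: (aux _ _ ij iN sj si).
Qed.

Lemma slot_lt i j x y : (i < j)%N -> (j <= N)%N -> slot i x -> slot j y -> y < x.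
Proof.
move=> ij jN [_ h1] [h2 _]; apply: lt_trans (h2 i ij) (h1 i _); lia.
Qed.

Lemma slot_between i x y z : slot i x -> slot i z -> x <= y <= z -> slot i y.
Proof.
move=> [_ h1] [h2 _] /andP[xy yz]; split=> k hk.
  exact: le_lt_trans yz (h2 _ hk).
exact: lt_le_trans (h1 _ hk) xy.
Qed.

(** The monodromy is triangular at this root, so Delta is the sum of two reciprocal numbers. Their
    common sign is that of [u N.+2], which the interlacing determines. *)
Lemma disc_at_dirichlet_root i : (i < N)%N -> 2 <= (-1) ^+ i.+1 * D.[nu N i].
Proof.
move=> iN; set x := nu N i.
have [uR uR' int] := nuP N; rewrite /= in uR uR' int.
have ux : (u N.+1).[x] = 0 by exact: roots_of_degreeP uR iN.
have [_ _ l1] := dirichlet_sol_size b al_gt0 N.+1.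
have dec j k : (j < k < N.+1)%N -> nu N.+1 k < nu N.+1 j.
  by apply: decreasing_lt => m; exact: dirichlet_roots_dec.
have usgn : 0 <= (-1) ^+ i.+1 * (u N.+2).[x].
  apply: (roots_of_degree_sign uR' l1); first lia.
  - move=> k ki; have /andP[_ h] := int i iN; apply: lt_le_trans h _.
    by have [->//|ne] := eqVneq k i; apply/ltW/dec; lia.
  - move=> k /andP[ik kN]; have /andP[h _] := int i iN; apply: le_trans (ltW h).
    by have [->//|ne] := eqVneq k i.+1; apply/ltW/dec; lia.
have det := monodromy_det b al_gt0 al_per x.
rewrite -/u -/v ux mulr0 subr0 in det.
have DE : D.[x] = (u N.+2).[x] + (v N.+1).[x] by rewrite hornerD.
rewrite DE mulrDr.
set s := (-1) ^+ i.+1 * (u N.+2).[x] in usgn *.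
set t := (-1) ^+ i.+1 * (v N.+1).[x].
have st : s * t = 1.
  by rewrite /s /t mulrACA -expr2 sqrr_sign mul1r.
have s0 : s != 0 by apply/eqP => s0; move: st; rewrite s0 mul0r => /eqP; rewrite eq_sym oner_eq0.
have sp : 0 < s by rewrite lt_def s0.
have : 0 <= (s - t) ^+ 2 by exact: sqr_ge0.
have -> : (s - t) ^+ 2 = (s + t) ^+ 2 - 4 * (s * t) by ring.
rewrite st => h; have t0 : 0 < t by rewrite -(pmulr_rgt0 _ sp) st.
nra.
Qed.

Lemma disc_slot_ge2 i : (i < N)%N -> 2 <= `|D.[nu N i]|.
Proof.
move=> iN; apply: le_trans (disc_at_dirichlet_root iN) _.
by apply: le_trans (ler_norm _) _; rewrite normrM normrX normrN normr1 expr1n mul1r.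
Qed.

(** Delta - c has degree [N.+1] and alternates in sign at the [N] roots of [u N.+1], so each slot
    contains exactly one solution of Delta = c. Existence, intervals and numbering of the bands all
    rest on this. *)
Lemma disc_roots c : `|c| < 2 -> exists z : nat -> R,
  (forall i, (i <= N)%N -> slot i (z i) /\ D.[z i] = c) /\
  (forall x, D.[x] = c -> exists2 i, (i <= N)%N & x = z i).
Proof.
rewrite ltr_norml => /andP[c1 c2].
have sD := disc_poly_size b N al_gt0; have lD := disc_poly_lead b N al_gt0.
have szc : (size (- c%:P) < size D)%N.
  by rewrite size_polyN (leq_ltn_trans (size_polyC_leq1 _))// /D sD.
have sDc : size (D - c%:P) = N.+2 by rewrite size_polyDl// /D sD.
have lDc : 0 < lead_coef (D - c%:P) by rewrite lead_coefDl.
have [i iN|i iN|z [zR zint _]] := alternating_roots (y := nu N) sDc lDc.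
- exact: dirichlet_roots_dec.
- rewrite hornerD hornerN hornerC mulrBr; have := disc_at_dirichlet_root iN.
  have : (-1) ^+ i.+1 * c < 2.
    apply: le_lt_trans (ler_norm _) _.
    by rewrite normrM normrX normrN normr1 expr1n mul1r ltr_norml c1.
  by move=> h1 h2; rewrite subr_gt0; apply: lt_le_trans h1 _.
have dec j k : (j < k < N)%N -> nu N k < nu N j.
  by apply: decreasing_lt => m; exact: dirichlet_roots_dec.
have root0 i : (i <= N)%N -> D.[z i] = c.
  move=> iN; have := roots_of_degreeP (n := N.+1) zR (i := i) iN.
  by rewrite hornerD hornerN hornerC => /eqP; rewrite subr_eq0 => /eqP.
exists z; split=> [i iN|x Dx]; last first.
  have [||i iN ->] := roots_of_degree_root (n := N.+1) (x := x) zR.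
  - by rewrite -lead_coef_eq0 gt_eqF.
  - by rewrite hornerD hornerN hornerC Dx subrr.
  - by exists i.
split; last exact: root0.
split=> k hk.
- have /andP[h _] := zint i.-1 (ltac:(lia)).
  rewrite prednK in h; last lia.
  by apply: lt_le_trans h _; have [->//|ne] := eqVneq k i.-1; apply/ltW/dec; lia.
- have /andP[_ h] := zint i (ltac:(lia)).
  by apply: le_lt_trans h; have [->//|ne] := eqVneq k i; apply/ltW/dec; lia.
Qed.

Lemma disc_slot_inj i x y : (i <= N)%N -> slot i x -> slot i y ->
  `|D.[x]| < 2 -> D.[x] = D.[y] -> x = y.
Proof.
move=> iN sx sy Dx e; have [z [zs zr]] := disc_roots Dx.
have [j jN xj] := zr x erefl; have [k kN yk] := zr y (esym e).
have [sj _] := zs j jN; have [sk _] := zs k kN.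
rewrite xj in sx *; rewrite yk in sy *.
by rewrite -(slot_inj iN jN sx sj) -(slot_inj iN kN sy sk).
Qed.

Lemma disc_in_slot x : `|D.[x]| < 2 -> exists2 i, (i <= N)%N & slot i x.
Proof.
move=> Dx; have [z [zs zr]] := disc_roots Dx.
by have [j jN ->] := zr x erefl; exists j => //; have [] := zs j jN.
Qed.

Lemma slot_phase x r phi J i : floquet_polar al b N x r phi J ->
  `|D.[x]| < 2 -> (i <= N)%N -> slot i x ->
  i%:R * pi < \sum_(k < N.+1) phi k < i.+1%:R * pi.
Proof.
move=> P Dx iN [h1 h2].
have /andP[-> h] := sturm_phase P iN h1 (fun k hk => ltW (h2 k hk)).
rewrite lt_neqAle h andbT; apply/eqP => e.
move: Dx; rewrite (fp_disc P) e [_ * pi]mulr_natl -[pi *+ _]add0r alternatingn; last exact: cosDpi.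
by rewrite cos0 mulr1 normrM normrX normrN normr1 expr1n mulr1 gtr0_norm ?ltxx.
Qed.

(** The derivative of 2 A cos (theta / q), with theta expressed through [acos] and the discriminant
    and q = [N.+1]. *)
Definition band_speed (A : R) (i : nat) (x : R) : R :=
  A / N.+1%:R * sin ((i%:R * pi + acos ((-1) ^+ i * D.[x] / 2)) / N.+1%:R) *
  ((-1) ^+ i * D^`().[x] / Num.sqrt (1 - ((-1) ^+ i * D.[x] / 2) ^+ 2)).

(** The Floquet phase t lies between i pi and (i + 1) pi, so the [acos] equals t - i pi and the
    square root equals (-1)^i sin t; the signs and the sine cancel against the derivative formula
    [fp_deriv]. *)
Lemma band_speedE A i x r phi J : floquet_polar al b N x r phi J ->
  `|D.[x]| < 2 -> (i <= N)%N -> slot i x ->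
  band_speed A i x = A * ((\sum_(n < N.+1) r n ^+ 2) / N.+1%:R *
    sin ((\sum_(n < N.+1) phi n) / N.+1%:R)) / J.
Proof.
move=> P Dx iN si; have /andP[t1 t2] := slot_phase P Dx iN si.
set t := \sum_(n < N.+1) phi n in t1 t2 *.
have Dt : D.[x] = 2 * cos t by exact: fp_disc P.
have fE : (-1) ^+ i * D.[x] / 2 = cos (t - i%:R * pi).
  have := alternatingn (@cosDpi R) i (t - i%:R * pi).
  rewrite -[pi *+ i]mulr_natl subrK => e.
  rewrite Dt e; transitivity (((-1) ^+ i) ^+ 2 * cos (t - i%:R * pi)).
    by field.
  by rewrite sqrr_sign mul1r.
have aE : acos ((-1) ^+ i * D.[x] / 2) = t - i%:R * pi.
  rewrite fE cosK// in_itv /=; move: t2; rewrite -natr1 mulrDl mul1r => t2.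
  by apply/andP; split; lra.
have sE : Num.sqrt (1 - ((-1) ^+ i * D.[x] / 2) ^+ 2) = (-1) ^+ i * sin t.
  rewrite fE -sin2cos2 sqrtr_sqr.
  have := alternatingn (@sinDpi R) i (t - i%:R * pi).
  rewrite -[pi *+ i]mulr_natl subrK => e.
  have s0 : 0 < (-1) ^+ i * sin t by apply: sin_sign; rewrite t1.
  by rewrite -(gtr0_norm s0) e mulrA -expr2 sqrr_sign mul1r.
have s0 : 0 < (-1) ^+ i * sin t by apply: sin_sign; rewrite t1.
have J0 := fp_J_gt0 P; have dE := fp_deriv P.
rewrite /band_speed sE aE [_ + (t - _)]addrC subrK.
have -> : (-1) ^+ i * D^`().[x] / ((-1) ^+ i * sin t) = (\sum_(n < N.+1) r n ^+ 2) / J.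
  have st0 : sin t != 0 by apply: contraTneq s0 => ->; rewrite mulr0 ltxx.
  have sg0 : (-1 : R) ^+ i != 0 by rewrite signr_eq0.
  apply: (mulIf (lt0r_neq0 J0)); rewrite divfK ?gt_eqF//.
  transitivity ((D^`().[x] * J) / sin t); first by field; rewrite st0 sg0.
  by rewrite dE -/t mulrC mulKf.
have q0 : N.+1%:R != 0 :> R by rewrite pnatr_eq0.
move: (N.+1%:R) q0 => q q0; by field; rewrite gt_eqF.
Qed.

Lemma band_speed_ge1 A i x : 0 < A -> A ^+ N.+1 = \prod_(n < N.+1) al n ->
  `|D.[x]| < 2 -> (i <= N)%N -> slot i x ->
  1 <= band_speed A i x /\
  (band_speed A i x = 1 -> forall n, (n <= N)%N -> al n = al 0 /\ b n.+1 = b 1).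
Proof.
move=> A0 AE Dx iN si; have [r [phi [J P]]] := floquet_polarP al_gt0 al_per Dx.
have J0 := fp_J_gt0 P; rewrite (band_speedE A P Dx iN si).
have rN0 : r N.+1 = r 0 by rewrite (fp_r0 P) (fp_rN P).
have [le1 eq1] := current_bound (ltn0Sn N) A0 AE (fp_r_gt0 P) rN0 (fp_phi P)
  (fun n _ => fp_current P n) J0.
split; first by rewrite ler_pdivlMr// mul1r.
move=> /(congr1 (fun y => y * J)); rewrite divfK ?gt_eqF// mul1r => /esym /eq1 rphi.
have r1 n : (n <= N.+1)%N -> r n = 1.
  rewrite leq_eqVlt => /orP[/eqP ->|nN]; first exact: fp_rN P.
  by have [-> _] := rphi n nN; exact: fp_r0 P.
have ph n : (n <= N)%N -> phi n = phi 0 by move=> nN; have [] := rphi n nN.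
have sph : sin (phi 0) != 0 by rewrite gt_eqF// sin_gt0_pi// (fp_phi P).
have alE n : (n <= N)%N -> al n = al 0.
  move=> nN; apply: (mulIf sph).
  have := fp_current P n; rewrite -(fp_current P 0) r1 ?(leqW nN)// r1// ph// r1// r1//.
  by rewrite !mul1r.
(* The equality case says nothing about [phi N.+1]; the index [N.+1], needed by the last recurrence,
   is covered by [fp_per]. *)
have e n : (n <= N.+1)%N -> al n * (r n * r n.+1 * cos (phi n)) = al 0 * cos (phi 0).
  rewrite leq_eqVlt => /orP[/eqP ->|nN].
    by rewrite (fp_per P) al_per r1// r1// !mul1r.
  by rewrite r1 1?ltnW// r1// ph// alE// !mul1r.
move=> n nN; split; first exact: alE.
have bE m : (m <= N)%N -> x - b m.+1 = al 0 * cos (phi 0) + al 0 * cos (phi 0).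
  move=> mN; have := fp_rec P m; rewrite e// e ?(leqW mN)// r1//.
  by rewrite expr1n mulr1.
have := bE n nN; rewrite -(bE 0%N (leq0n _)) => /eqP.
by rewrite (inj_eq (addrI x)) (inj_eq oppr_inj) => /eqP.
Qed.

(** For constant coefficients v is minus the shift of u. This forces |psi_1| = 1 and x - b = 2 a cos
    phi_0, and the recurrence then propagates modulus 1 and the step angle phi_0 to all n. *)
Lemma band_speed_const A i x : 0 < A -> A ^+ N.+1 = \prod_(n < N.+1) al n ->
  (forall n, al n = al 0) -> (forall n, b n.+1 = b 1) ->
  `|D.[x]| < 2 -> (i <= N)%N -> slot i x -> band_speed A i x = 1.
Proof.
move=> A0 AE ac bc Dx iN si; have [r [phi [J P]]] := floquet_polarP al_gt0 al_per Dx.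
have J0 := fp_J_gt0 P; rewrite (band_speedE A P Dx iN si).
have u0 := dirichlet_sol_neq0 al_gt0 al_per Dx; rewrite -/u in u0.
have a0 := lt0r_neq0 (al_gt0 0).
have AE' : A = al 0.
  move: AE; rewrite (eq_bigr (fun=> al 0)); last by move=> n _; rewrite ac.
  rewrite prodr_const card_ord => /eqP.
  by rewrite eqrXn2 ?(ltW A0) ?(ltW (al_gt0 0))// => /eqP.
have vu n : v n.+1 = - u n.
  have [] : v n.+1 = - u n /\ v n.+2 = - u n.+1; last by [].
  elim: n => [|n [IH1 IH2]].
    split; first by rewrite /v /u /= oppr0.
    rewrite [v 2](_ : _ = (al 1)^-1 *: (('X - (b 1)%:P) * 0 - al 0 *: 1))//.
    by rewrite mulr0 sub0r ac scalerN scalerA mulVf// scale1r.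
  split=> //.
  rewrite [v n.+3](_ : _ = (al n.+2)^-1 *: (('X - (b n.+2)%:P) * v n.+2 - al n.+1 *: v n.+1))//.
  rewrite [u n.+2](_ : _ = (al n.+1)^-1 *: (('X - (b n.+1)%:P) * u n.+1 - al n *: u n))//.
  rewrite IH1 IH2 (ac n.+2) (ac n.+1) (ac n) (bc n.+1) (bc n).
  by rewrite -[RHS]scalerN opprB mulrN scalerN opprK addrC.
have r0 := fp_r0 P.
have r1 : r 1 = 1.
  have := fp_r1 P; rewrite -/u -/v vu hornerN opprK -[RHS]mul1r => /(mulIf u0) /eqP.
  rewrite sqrf_eq1 => /orP[/eqP//|/eqP e].
  by have := fp_r_gt0 P 1; rewrite e oppr_gt0 ltr10.
have xb n : x - b n.+1 = al 0 * cos (phi 0) + al 0 * cos (phi 0).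
  rewrite bc; apply: (mulIf u0).
  have := fp_cos0 P; rewrite -/u -/v vu hornerN opprK r1 mul1r => e.
  have := jacobi_solE b al_gt0 0 1 N x; rewrite -[jacobi_sol _ _ _ _]/u ac bc (ac N).
  move=> e'; apply/eqP; rewrite -subr_eq0; apply/eqP.
  transitivity (al 0 * ((u N.+2).[x] + (u N).[x] - 2 * cos (phi 0) * (u N.+1).[x])).
    by rewrite mulrBr mulrDr e'; ring.
  by rewrite e subrr mulr0.
have rphi n : [/\ r n = 1, r n.+1 = 1 & phi n = phi 0].
  elim: n => [|n [IH1 IH2 IH3]]; first by [].
  have recn := fp_rec P n; rewrite xb IH1 IH2 IH3 !ac expr1n mulr1 !mul1r in recn.
  have {}recn := mulfI a0 (addIr _ recn).
  (* The recurrence has fixed r_(n+2) cos phi_(n+1), and the current fixes r_(n+2) sin phi_(n+1);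
     squaring and adding yields the modulus. *)
  have cn := fp_current P n; have cn1 := fp_current P n.+1.
  rewrite ac IH1 IH2 IH3 !mul1r in cn; rewrite ac IH2 mul1r -cn in cn1.
  have {}cn1 := mulfI a0 cn1.
  have rr : r n.+2 = 1.
    have : r n.+2 ^+ 2 = 1.
      by rewrite -[LHS]mulr1 -[X in _ * X = _](cos2Dsin2 (phi n.+1)) mulrDr -!exprMn -recn
        cn1 cos2Dsin2.
    move/eqP; rewrite sqrf_eq1 => /orP[/eqP//|/eqP e].
    by have := fp_r_gt0 P n.+2; rewrite e oppr_gt0 ltr10.
  split=> //; rewrite rr mul1r in recn.
  have /andP[p1 p2] := fp_phi P n.+1; have /andP[p3 p4] := fp_phi P 0.
  by apply: cos_inj => //; rewrite in_itv /= ?(ltW p1) ?(ltW p2) ?(ltW p3) ?(ltW p4).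
have JE : J = al 0 * sin (phi 0) by rewrite -(fp_current P 0) r0 r1 !mul1r.
have q0 : N.+1%:R != 0 :> R by rewrite pnatr_eq0.
have -> : \sum_(n < N.+1) r n ^+ 2 = \sum_(n < N.+1) 1.
  by apply: eq_bigr => n _; have [-> _ _] := rphi n; rewrite expr1n.
have -> : \sum_(n < N.+1) phi n = \sum_(n < N.+1) phi 0.
  by apply: eq_bigr => n _; have [_ _ ->] := rphi n.
rewrite !sumr_const card_ord -[phi 0 *+ _]mulr_natr mulfK// divff// mul1r AE' -JE.
by rewrite divff// gt_eqF.
Qed.

End Slots.

(** * Band lengths *)

(** The length is supplied as the least upper bound of the differences, so that later estimates
    never involve the edges of a band. *)
Lemma measure_closure_interval (R : realType) (C : set R) (B : R) :
  is_interval C -> C !=set0 -> (forall x y, C x -> C y -> y - x <= B) ->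
  exists L : R, [/\ lebesgue_measure (closure C) = L%:E,
    (forall x y, C x -> C y -> y - x <= L) &
    forall B', (forall x y, C x -> C y -> y - x <= B') -> L <= B'].
Proof.
move=> Ci [c0 Cc0] CB.
have ubC : has_ubound C.
  by exists (B + c0) => y Cy; have := CB _ _ Cc0 Cy; lra.
have lbC : has_lbound C.
  by exists (c0 - B) => y Cy; have := CB _ _ Cy Cc0; lra.
have supC x : C x -> x <= sup C by exact: ub_le_sup.
have infC x : C x -> inf C <= x by exact: ge_inf.
have inf_sup : inf C <= sup C by exact: le_trans (infC _ Cc0) (supC _ Cc0).
exists (sup C - inf C); split.
- have mcl : measurable (closure C).
    by apply: measurable_realfun.closed_measurable; exact: closed_closure.
  have oo : [set` `]inf C, sup C[%R] `<=` closure C.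
    move=> x /=; rewrite in_itv /= => /andP[xi xs]; apply: subset_closure.
    have [y Cy yx] := inf_lt (ex_intro _ c0 Cc0) xi.
    have [z Cz xz] := sup_gt (ex_intro _ c0 Cc0) xs.
    by apply: (Ci y z) => //; rewrite !ltW.
  have cc : closure C `<=` [set` `[inf C, sup C]].
    rewrite (closure_id [set` `[inf C, sup C]]).1; last exact: itv_closed.
    by apply: closureS => x Cx /=; rewrite in_itv /= infC// supC.
  have len (i : interval R) : (i = `]inf C, sup C[%R) \/ (i = `[inf C, sup C]%R) ->
      lebesgue_measure ([set` i] : set R) = (sup C - inf C)%:E.
    move: inf_sup; rewrite le_eqVlt => /orP[/eqP e|lt_is].
      by rewrite lebesgue_measure_itv => -[->|->] /=; rewrite e lte_fin ltxx subrr.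
    by rewrite lebesgue_measure_itv => -[->|->] /=; rewrite lte_fin lt_is EFinB.
  apply/eqP; rewrite eq_le; apply/andP; split.
    rewrite -(len `[inf C, sup C]%R); last by right.
    by apply: le_measure; rewrite ?inE//=; exact: measurable_itv.
  rewrite -(len `]inf C, sup C[%R); last by left.
  by apply: le_measure; rewrite ?inE//=; exact: measurable_itv.
- by move=> x y Cx Cy; have := supC _ Cy; have := infC _ Cx; lra.
- move=> B' CB'; rewrite lerBlDr; apply: ge_sup; first by exists c0.
  move=> y Cy; rewrite -lerBlDl; apply: lb_le_inf; first by exists c0.
  by move=> x Cx; have := CB' _ _ Cx Cy; lra.
Qed.

Lemma ler_cos (R : realType) (s t : R) : 0 <= s -> s <= t -> t <= pi -> cos t <= cos s.
Proof.
move=> s0 st tpi; rewrite leNgt ltr_cos ?in_itv /= ?s0 ?tpi ?(le_trans s0)//.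
  by rewrite -leNgt.
exact: le_trans tpi.
Qed.

(** * The bands as connected components *)

Section Bands.
Variables (R : realType) (al b : nat -> R) (N : nat) (nu : nat -> nat -> R).
Hypothesis al_gt0 : forall n, 0 < al n.
Hypothesis al_per : al N.+1 = al 0.
Hypothesis nuP : forall n, interlaced_roots al b n (nu n, nu n.+1).

Let D := disc_poly al b N.
Let S := [set E : R | `|D.[E]| < 2].

Definition open_band (i : nat) := [set E : R | S E /\ slot N nu i E].

Lemma open_band_neq0 i : (i <= N)%N -> open_band i !=set0.
Proof.
move=> iN; have [|z [zs _]] := @disc_roots _ al b N nu al_gt0 al_per nuP 0.
  by rewrite normr0.
by exists (z i); have [si Di] := zs i iN; split => //; rewrite /S /= Di normr0.
Qed.

(** If |Delta| reached 2 at an intermediate point, some value of modulus below 2 would be taken on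
    both sides of that point, although Delta takes such a value only once in a slot. *)
Lemma open_band_interval i : (i <= N)%N -> is_interval (open_band i).
Proof.
move=> iN x y [Sx sx] [Sy sy] z /andP[xz zy].
have sz : slot N nu i z by apply: (slot_between sx sy); rewrite xz.
split=> //; rewrite /S /= ltNge; apply/negP => Dz.
have [s s1 sDz] : exists2 s : R, `|s| = 1 & 2 <= s * D.[z].
  move: Dz; rewrite ler_normr => /orP[h|h].
    by exists 1; rewrite ?normr1 ?mul1r.
  by exists (-1); rewrite ?normrN ?normr1 ?mulN1r.
have sDlt t : S t -> s * D.[t] < 2.
  by move=> St; apply: le_lt_trans (ler_norm _) _; rewrite normrM s1 mul1r.
have sDgt t : S t -> -2 < s * D.[t].
  move=> St; rewrite ltrNl; apply: le_lt_trans (ler_norm _) _.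
  by rewrite normrN normrM s1 mul1r.
have [hx hy] := (sDlt _ Sx, sDlt _ Sy).
have [gx gy] := (sDgt _ Sx, sDgt _ Sy).
(* Halfway between 2 and the larger of the two signed endpoint values, so that it is crossed on both
   sides of [z]. *)
pose c := (Num.max (s * D.[x]) (s * D.[y]) + 2) / 2.
have [cx cy c2] : [/\ s * D.[x] < c, s * D.[y] < c & c < 2].
  have hm : Num.max (s * D.[x]) (s * D.[y]) < 2 by rewrite gt_max hx.
  have m1 : s * D.[x] <= Num.max (s * D.[x]) (s * D.[y]) by rewrite le_max lexx.
  have m2 : s * D.[y] <= Num.max (s * D.[x]) (s * D.[y]) by rewrite le_max lexx orbT.
  by rewrite /c; split; lra.
pose p := s *: D - c%:P.
have pE t : p.[t] = s * D.[t] - c by rewrite /p hornerD hornerN hornerC hornerZ.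
have pz : 0 < p.[z] by rewrite pE; lra.
have px : p.[x] < 0 by rewrite pE; lra.
have py : p.[y] < 0 by rewrite pE; lra.
have [t1] := poly_ivtoo xz (ltac:(by rewrite pmulr_llt0) : p.[x] * p.[z] < 0).
rewrite in_itv /= => /andP[xt1 t1z] /eqP; rewrite pE => e1.
have [t2] := poly_ivtoo zy (ltac:(by rewrite pmulr_rlt0) : p.[z] * p.[y] < 0).
rewrite in_itv /= => /andP[zt2 t2y] /eqP; rewrite pE => e2.
have s0 : s != 0 by rewrite -normr_eq0 s1 oner_eq0.
have D12 : D.[t1] = D.[t2].
  by apply: (mulfI s0); rewrite -[LHS](subrK c) e1 -[RHS](subrK c) e2.
have Dt1 : `|D.[t1]| < 2.
  have -> : `|D.[t1]| = `|s * D.[t1]| by rewrite normrM s1 mul1r.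
  by rewrite -[s * _](subrK c) e1 add0r ltr_norml c2 andbT; lra.
have st1 : slot N nu i t1 by apply: (slot_between sx sy); apply/andP; split; lra.
have st2 : slot N nu i t2 by apply: (slot_between sx sy); apply/andP; split; lra.
have := disc_slot_inj al_gt0 al_per nuP iN st1 st2 Dt1 D12; lra.
Qed.

(** A connected subset of [S] meeting two slots would contain a root of [u N.+1], where |Delta| >=
    2. *)
Lemma open_band_component i x : (i <= N)%N -> open_band i x ->
  connected_component S x = open_band i.
Proof.
move=> iN Bx; apply/seteqP; split; last first.
  apply: connected_component_max => //; first by move=> y [].
  exact/connected_intervalP/open_band_interval.
move=> y [C [Cx CS Cc] Cy].
have Ci : is_interval C by exact/connected_intervalP.
have [Sx sx] := Bx; have Sy := CS _ Cy; split => //.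
have [j jN sy] := disc_in_slot al_gt0 al_per nuP Sy.
have sep k l s t : (k < l)%N -> (l <= N)%N -> slot N nu k s -> slot N nu l t ->
    C s -> C t -> False.
  move=> kl lN [_ h1] [h2 _] Cs Ct.
  have : S (nu N k).
    by apply/CS/(Ci t s) => //; rewrite !ltW ?h1 ?h2//; lia.
  rewrite /S /= ltNge => /negP; apply; apply: disc_slot_ge2 => //; lia.
have [ij|ji|->//] := ltngtP i j; first by case: (sep _ _ _ _ ij jN sx sy Cx Cy).
by case: (sep _ _ _ _ ji iN sy sx Cy Cx).
Qed.

Lemma components_open_band (B : set R) :
  [set connected_component S E | E in S] B <-> exists2 i, (i <= N)%N & B = open_band i.
Proof.
split=> [[E SE <-]|[i iN ->]].
  have [i iN si] := disc_in_slot al_gt0 al_per nuP SE.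
  by exists i => //; apply: open_band_component.
have [x Bx] := open_band_neq0 iN; have [Sx _] := Bx.
by exists x => //; exact: open_band_component.
Qed.

Lemma left_of_open_band i j : (i <= N)%N -> (j <= N)%N ->
  left_of (open_band i) (open_band j) <-> (j < i)%N.
Proof.
move=> iN jN; split=> [h|ji x y [_ sx] [_ sy]]; last exact: slot_lt ji iN sy sx.
have [[x Bx] [y By]] := (open_band_neq0 iN, open_band_neq0 jN).
have := h x y Bx By; have [_ sx] := Bx; have [_ sy] := By.
have [ij|//|ij] := ltngtP i j => xy; last first.
  by rewrite ij in Bx; have := h x x; rewrite ij ltxx => /(_ Bx Bx).
by have := lt_trans xy (slot_lt ij jN sx sy); rewrite ltxx.
Qed.

Lemma open_band_inj i j : (i <= N)%N -> (j <= N)%N -> open_band i = open_band j -> i = j.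
Proof.
move=> iN jN e; have [x Bx] := open_band_neq0 iN.
have [_ sx] := Bx; rewrite e in Bx; have [_ sx'] := Bx; exact: slot_inj iN jN sx sx'.
Qed.

Lemma card_right_of_open_band i : (i <= N)%N ->
  ([set C | [set connected_component S E | E in S] C /\ left_of (open_band i) C]
    #= `I_i)%card.
Proof.
move=> iN.
have -> : [set C | [set connected_component S E | E in S] C /\ left_of (open_band i) C]
    = open_band @` `I_i.
  apply/seteqP; split=> [C [/components_open_band[j jN ->] /left_of_open_band]|_ [j ji <-]].
    by move=> /(_ iN jN) ji; exists j.
  have jN : (j <= N)%N by exact: leq_trans (ltnW ji) iN.
  split; last exact/left_of_open_band.
  by apply/components_open_band; exists j.
apply: inj_card_eq => j k; rewrite !inE /= => ji ki; apply: open_band_inj.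
  exact: leq_trans (ltnW ji) iN.
exact: leq_trans (ltnW ki) iN.
Qed.

(** * The expanding coordinate on a band *)

Variable A : R.
Hypothesis A_gt0 : 0 < A.
Hypothesis AE : A ^+ N.+1 = \prod_(n < N.+1) al n.

Let theta (i : nat) (x : R) : R := (i%:R * pi + acos ((-1) ^+ i * D.[x] / 2)) / N.+1%:R.

(** The energy at which the Jacobi matrix with constant coefficients a = A and b = 0 has the same
    phase over [N.+1] sites. A band is thus compared with its counterpart for that matrix. *)
Definition band_coord (i : nat) (x : R) : R := 2 * A * cos (theta i x).

Lemma signed_disc_itv i x : S x -> -1 < (-1) ^+ i * D.[x] / 2 < 1.
Proof.
move=> Sx; rewrite -ltr_norml !normrM normrX normrN normr1 expr1n mul1r.
by rewrite [`|2^-1|]ger0_norm ?invr_ge0// ltr_pdivrMr// mul1r.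
Qed.

Lemma is_derive_band_coord i x : S x ->
  is_derive x (1 : R) (band_coord i) (band_speed al b N A i x).
Proof.
move=> Sx; have dI := signed_disc_itv i Sx.
have q0 : N.+1%:R != 0 :> R by rewrite pnatr_eq0.
have h1 : is_derive x (1 : R) (fun y : R => (-1) ^+ i * D.[y] / 2) ((-1) ^+ i * D^`().[x] / 2).
  have := is_derive_poly (((-1) ^+ i / 2) *: D) x.
  rewrite derivZ hornerZ mulrAC.
  have -> // : horner (((-1) ^+ i / 2) *: D) = (fun y : R => (-1) ^+ i * D.[y] / 2).
  by apply/funext => y; rewrite hornerZ mulrAC.
have h2 := @is_derive1_comp R (@acos R) (fun y : R => (-1) ^+ i * D.[y] / 2) x _ _
  (is_derive1_acos dI) h1.
have h3 : is_derive x (1 : R) (theta i)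
   (- (Num.sqrt (1 - ((-1) ^+ i * D.[x] / 2) ^+ 2))^-1 * ((-1) ^+ i * D^`().[x] / 2) / N.+1%:R).
  have -> : theta i = (fun y => (N.+1%:R)^-1 *
      (i%:R * pi + (@acos R \o (fun y : R => (-1) ^+ i * D.[y] / 2)) y)).
    by apply/funext => y; rewrite /theta /= mulrC.
  by apply: is_derive_eq; rewrite /GRing.scale /= add0r mul1r mulrC.
have h4 := @is_derive1_comp R (@cos R) (theta i) x _ _ (is_derive_cos _) h3.
have -> : band_coord i = (fun y => (2 * A) * (@cos R \o theta i) y) by [].
apply: is_derive_eq; rewrite /GRing.scale /= /band_speed -/D -/(theta i x).
have := Num.sqrt (1 - ((-1) ^+ i * D.[x] / 2) ^+ 2).
have s0 : Num.sqrt (1 - ((-1) ^+ i * D.[x] / 2) ^+ 2) != 0.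
  have /andP[d1 d2] := dI; rewrite gt_eqF// sqrtr_gt0; nra.
move: (Num.sqrt _) s0 (N.+1%:R) q0 => w w0 q q0 _.
by field; rewrite w0 q0.
Qed.

Lemma band_coord_mvt i x y : (i <= N)%N -> open_band i x -> open_band i y -> x < y ->
  exists2 z, open_band i z &
    band_coord i y - band_coord i x = band_speed al b N A i z * (y - x).
Proof.
move=> iN Bx By xy.
have Bz z : x <= z <= y -> open_band i z by exact: (open_band_interval iN Bx By).
have dg z : x <= z <= y -> is_derive z (1 : R) (band_coord i) (band_speed al b N A i z).
  by move=> /Bz[Sz _]; exact: is_derive_band_coord.
have [||z] := @MVT R (band_coord i) (band_speed al b N A i) x y xy.
- by move=> z; rewrite in_itv /= => /andP[h1 h2]; apply: dg; rewrite !ltW.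
- apply: continuous_in_subspaceT => z; rewrite inE /= in_itv /= => /dg h.
  by apply/differentiable_continuous/derivable1_diffP; apply: ex_derive.
- rewrite in_itv /= => /andP[h1 h2] e; exists z => //; apply: Bz.
  by rewrite !ltW.
Qed.

Lemma band_coord_itv i x y : (i <= N)%N -> S x -> S y ->
  band_coord i y - band_coord i x <=
  2 * A * (cos (i%:R * pi / N.+1%:R) - cos (i.+1%:R * pi / N.+1%:R)).
Proof.
move=> iN Sx Sy.
have q0 : 0 < N.+1%:R :> R by rewrite ltr0n.
have p0 := pi_gt0 R.
have th t : S t -> i%:R * pi / N.+1%:R <= theta i t <= i.+1%:R * pi / N.+1%:R.
  move=> /(signed_disc_itv i)/andP[d1 d2].
  have h1 : 0 <= acos ((-1) ^+ i * D.[t] / 2) by rewrite acos_ge0// !ltW.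
  have h2 : acos ((-1) ^+ i * D.[t] / 2) <= pi by rewrite acos_lepi// !ltW.
  rewrite /theta !ler_pM2r ?invr_gt0// lerDl h1 /=.
  by rewrite -[i.+1%:R]natr1 mulrDl mul1r lerD2l.
have e1 : (0 : R) <= i%:R * pi / N.+1%:R.
  by apply: divr_ge0; [apply: mulr_ge0; [exact: ler0n|exact: pi_ge0]|exact: ltW].
have e2 : i.+1%:R * pi / N.+1%:R <= pi :> R.
  by rewrite ler_pdivrMr// mulrC ler_pM2l ?pi_gt0// ler_nat.
rewrite /band_coord -mulrBr ler_pM2l; last by rewrite mulr_gt0.
have /andP[a1 a2] := th _ Sx; have /andP[b1 b2] := th _ Sy.
apply: lerB.
- exact: (ler_cos e1 b1 (le_trans b2 e2)).
- exact: (ler_cos (le_trans e1 a1) a2 e2).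
Qed.

Let width (i : nat) : R :=
  2 * A * (cos (i%:R * pi / N.+1%:R) - cos (i.+1%:R * pi / N.+1%:R)).

Lemma open_band_speed_ge1 i x : (i <= N)%N -> open_band i x ->
  1 <= band_speed al b N A i x /\
  (band_speed al b N A i x = 1 -> forall n, (n <= N)%N -> al n = al 0 /\ b n.+1 = b 1).
Proof. by move=> iN [Sx sx]; exact: (band_speed_ge1 al_gt0 al_per nuP A_gt0 AE Sx iN sx). Qed.

Lemma band_coord_expanding i x y : (i <= N)%N -> open_band i x -> open_band i y ->
  x <= y -> y - x <= band_coord i y - band_coord i x.
Proof.
move=> iN Bx By; rewrite le_eqVlt => /orP[/eqP ->|xy]; first by rewrite !subrr.
have [z Bz ->] := band_coord_mvt iN Bx By xy.
by rewrite -[leLHS]mul1r ler_pM2r ?subr_gt0//; have [] := open_band_speed_ge1 iN Bz.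
Qed.

Lemma open_band_width i x y : (i <= N)%N -> open_band i x -> open_band i y ->
  y - x <= width i.
Proof.
move=> iN Bx By; have [xy|yx] := leP x y.
  apply: le_trans (band_coord_expanding iN Bx By xy) _.
  by have [[Sx _] [Sy _]] := (Bx, By); exact: band_coord_itv.
apply: (@le_trans _ _ 0); first by rewrite subr_le0 ltW.
by have := band_coord_itv iN Bx.1 Bx.1; rewrite subrr.
Qed.

(** The coordinate gains a surplus [d] over length on one fixed pair of points. Any other pair is
    enlarged to contain that one, and as the coordinate contracts nowhere, the surplus survives. *)
Lemma open_band_width_strict i : (i <= N)%N ->
  ~ (forall n, (n <= N)%N -> al n = al 0 /\ b n.+1 = b 1) ->
  exists2 d, 0 < d &
    forall x y, open_band i x -> open_band i y -> y - x <= width i - d.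
Proof.
move=> iN nconst.
(* The points of the slot where Delta is 0 and 1 are distinct. *)
have [x0 [y0 [Bx0 By0 xy0]]] : exists x y, [/\ open_band i x, open_band i y & x < y].
  have [|z [zs _]] := @disc_roots _ al b N nu al_gt0 al_per nuP 0; first by rewrite normr0.
  have [|t [ts _]] := @disc_roots _ al b N nu al_gt0 al_per nuP 1.
    by rewrite normr1 ltr1n.
  have [sz Dz] := zs i iN; have [st Dt] := ts i iN.
  have Bz : open_band i (z i) by split=> //; rewrite /S /= Dz normr0.
  have Bt : open_band i (t i) by split=> //; rewrite /S /= Dt normr1 ltr1n.
  have [h|h|h] := ltgtP (z i) (t i); [by exists (z i), (t i)|by exists (t i), (z i)|].
  by move: Dz; rewrite h Dt => /eqP; rewrite oner_eq0.
pose d := band_coord i y0 - band_coord i x0 - (y0 - x0).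
have d0 : 0 < d.
  have [z Bz e] := band_coord_mvt iN Bx0 By0 xy0.
  rewrite /d e subr_gt0 -[ltLHS]mul1r ltr_pM2r ?subr_gt0//.
  have [h1 h2] := open_band_speed_ge1 iN Bz.
  by rewrite lt_neqAle h1 andbT eq_sym; apply/eqP => /h2.
exists d => // x y Bx By.
have Bmin : open_band i (Num.min x x0) by case: leP.
have Bmax : open_band i (Num.max y y0) by case: leP.
have m1 : Num.min x x0 <= x by rewrite ge_min lexx.
have m2 : Num.min x x0 <= x0 by rewrite ge_min lexx orbT.
have m3 : y <= Num.max y y0 by rewrite le_max lexx.
have m4 : y0 <= Num.max y y0 by rewrite le_max lexx orbT.
have g1 := band_coord_expanding iN Bmin Bx0 m2.
have g2 := band_coord_expanding iN By0 Bmax m4.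
have g3 := band_coord_itv iN Bmin.1 Bmax.1.
rewrite -/(width i) in g3; rewrite /d; lra.
Qed.

(** The coordinate is now an isometry, and every phase strictly inside the band is attained; the
    points with phases [t] and [pi - t] beyond i pi exhaust the width as [t] tends to 0. *)
Lemma open_band_width_const i (L : R) : (i <= N)%N ->
  (forall n, al n = al 0) -> (forall n, b n.+1 = b 1) ->
  (forall x y, open_band i x -> open_band i y -> y - x <= L) -> width i <= L.
Proof.
move=> iN ac bc BL; have p0 := pi_gt0 R.
have coord t : 0 < t < pi -> exists2 x, open_band i x &
    band_coord i x = 2 * A * cos ((i%:R * pi + t) / N.+1%:R).
  move=> /andP[t0 tpi].
  have ct : -1 < cos t < 1.
    have c1 : cos t < 1 by rewrite -(cos0 R) ltr_cos ?in_itv /= ?lexx ?ltW.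
    have c2 : -1 < cos t by rewrite -(cospi R) ltr_cos ?in_itv /= ?lexx ?ltW.
    by rewrite c1 c2.
  have [|z [zs _]] := @disc_roots _ al b N nu al_gt0 al_per nuP (2 * ((-1) ^+ i * cos t)).
    rewrite normrM normrM normrX normrN normr1 expr1n mul1r gtr0_norm//.
    by rewrite -[ltRHS]mulr1 ltr_pM2l// ltr_norml.
  have [sz Dz] := zs i iN; exists (z i).
    split=> //; rewrite /S /= Dz normrM normrM normrX normrN normr1 expr1n mul1r.
    by rewrite gtr0_norm// -[ltRHS]mulr1 ltr_pM2l// ltr_norml.
  rewrite /band_coord /theta /D Dz.
  have -> : (-1) ^+ i * (2 * ((-1) ^+ i * cos t)) / 2 = ((-1) ^+ i) ^+ 2 * cos t by field.
  by rewrite sqrr_sign mul1r cosK// in_itv /= !ltW.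
have iso x y : open_band i x -> open_band i y -> band_coord i y - band_coord i x <= L.
  have aux s t : open_band i s -> open_band i t -> s < t ->
      band_coord i t - band_coord i s = t - s.
    move=> Bs Bt st; have [z [Sz sz] ->] := band_coord_mvt iN Bs Bt st.
    by rewrite (band_speed_const al_gt0 al_per nuP A_gt0 AE)// mul1r.
  move=> Bx By; have [xy|yx|->] := ltgtP x y.
  - by rewrite aux//; exact: BL.
  - by rewrite -opprB aux// opprB; exact: BL.
  - by rewrite subrr -(subrr y); exact: BL.
pose F (t : R) := 2 * A * (cos ((i%:R * pi + t) / N.+1%:R)
  - cos ((i%:R * pi + (pi - t)) / N.+1%:R)).
have Fcont : continuous F.
  move=> t; apply/differentiable_continuous/derivable1_diffP; exact: ex_derive.
have F0 : F 0 = width i.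
  by rewrite /F /width addr0 subr0 -[i.+1%:R]natr1 [(_ + 1) * pi]mulrDl mul1r.
have F0lim : F t @[t --> 0^'+] --> F 0.
  by apply: cvg_at_right_filter; exact: Fcont.
rewrite -F0; apply: (cvgr_to_le F0lim).
near=> t.
have t0 : 0 < t by near: t; exact: nbhs_right_gt.
have tpi : t < pi by near: t; exact: nbhs_right_lt.
have [y By ey] := coord t (ltac:(by rewrite t0)).
have [x Bx ex] := coord (pi - t) (ltac:(apply/andP; split; lra)).
by rewrite /F mulrBr -ey -ex; exact: iso.
Unshelve. all: by end_near.
Qed.

End Bands.

(** * From transfer matrices to the polynomial solutions *)

Section Discriminant.
Variables (R : realType) (N : nat) (a b : nat -> R).
Hypothesis a_gt0 : forall n, (1 <= n)%N -> 0 < a n.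

Let al := a_ext N.+1 a.
Let u := dirichlet_sol al b.
Let v := neumann_sol al b.

Lemma a_ext_gt0 n : 0 < a_ext N.+1 a n.
Proof. by rewrite /a_ext; case: n => [|n] /=; exact: a_gt0. Qed.

Lemma a_ext_per : a_ext N.+1 a N.+1 = a_ext N.+1 a 0.
Proof. by []. Qed.

(** Transfer matrices act on the pairs (psi_(n+1), psi_n), and [u] and [v] start from (1, 0) and (0,
    1), the columns of the identity. *)
Lemma monodromyE E n : monodromy N.+1 a b E n =
  \matrix_(i, k) if i == 0 then if k == 0 then (u n.+1).[E] else (v n.+1).[E]
                 else if k == 0 then (u n).[E] else (v n).[E].
Proof.
elim: n => [|n IH].
  apply/matrixP => i k; rewrite !mxE /u /v /= horner0 hornerC.
  by case: i k => [[|[|//]] ?] [[|[|//]] ?].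
rewrite /= IH; apply/matrixP => i k; rewrite !mxE !big_ord_recl big_ord0 addr0 !mxE /=.
have aE : a n.+1 = al n.+1 by [].
have a0 : al n.+1 != 0 by rewrite gt_eqF// a_ext_gt0.
have ue := jacobi_solE b a_ext_gt0 0 1 n E; have ve := jacobi_solE b a_ext_gt0 1 0 n E.
rewrite -/(dirichlet_sol _ _) -/al -/u in ue; rewrite -/(neumann_sol _ _) -/al -/v in ve.
rewrite -/al aE; case: (i == 0); case: (k == 0) => /=.
- by apply: (mulfI a0); rewrite ue; field.
- by apply: (mulfI a0); rewrite ve; field.
- by rewrite mul1r mul0r addr0.
- by rewrite mul1r mul0r addr0.
Qed.

Lemma discriminantE E : discriminant N.+1 a b E = (disc_poly al b N).[E].
Proof.
rewrite /discriminant monodromyE /mxtrace !big_ord_recl big_ord0 addr0 !mxE /=.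
by rewrite hornerD.
Qed.

Lemma geomean_gt0 : 0 < geomean N.+1 a.
Proof.
rewrite /geomean powR_gt0// big_seq prodr_gt0// => n.
by rewrite mem_index_iota => /andP[/a_gt0].
Qed.

Lemma geomean_exp : geomean N.+1 a ^+ N.+1 = \prod_(n < N.+1) al n.
Proof.
have p0 : 0 < \prod_(1 <= n < N.+2) a n.
  by rewrite big_seq prodr_gt0// => n; rewrite mem_index_iota => /andP[/a_gt0].
rewrite /geomean -powR_mulrn ?powR_ge0// -powRrM mulVf ?pnatr_eq0// powRr1 ?ltW//.
rewrite big_ord_recl big_nat_recr//= mulrC; congr (_ * _).
by rewrite big_add1 /= big_mkord.
Qed.

Lemma constant_seq_periodic (c : nat -> R) : periodic_seq N.+1 c ->
  (forall n, (n <= N)%N -> c n.+1 = c 1%N) -> constant_seq c.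
Proof.
move=> cper cN; exists (c 1%N); elim/ltn_ind => n IH n1.
have [nN|Nn] := leqP n N.+1; first by case: n n1 nN {IH} => // n _; exact: cN.
by rewrite -[n in LHS](subnK (ltnW Nn)) cper ?IH//; lia.
Qed.

End Discriminant.

(** The component of index k has exactly k components to its right, so this number determines the
    component and [xget] has a unique candidate. Bands are counted from 1 and slots from 0. *)
Lemma bandE (R : realType) (N : nat) (a b : nat -> R) (nu : nat -> nat -> R) (i : nat) :
  (forall n, (1 <= n)%N -> 0 < a n) ->
  (forall n, interlaced_roots (a_ext N.+1 a) b n (nu n, nu n.+1)) -> (i <= N)%N ->
  band N.+1 a b i.+1 = closure (open_band (a_ext N.+1 a) b N nu i).
Proof.
move=> a_gt0 nuP iN.
have al_gt0 := a_ext_gt0 N a_gt0; have al_per := a_ext_per N a.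
have SE : [set E : R | `|discriminant N.+1 a b E| < 2] =
    [set E : R | `|(disc_poly (a_ext N.+1 a) b N).[E]| < 2].
  by apply/seteqP; split=> E /=; rewrite (discriminantE N b a_gt0).
have bands C : open_bands N.+1 a b C <->
    exists2 k, (k <= N)%N & C = open_band (a_ext N.+1 a) b N nu k.
  by rewrite /open_bands SE; exact: (components_open_band al_gt0 al_per nuP).
have card k : (k <= N)%N ->
    ([set C | open_bands N.+1 a b C /\ left_of (open_band (a_ext N.+1 a) b N nu k) C]
      #= `I_k)%card.
  by move=> kN; rewrite /open_bands SE; exact: (card_right_of_open_band al_gt0 al_per nuP).
rewrite /band; apply: xget_unique => [|B [C [/bands[k kN ->] ck ->]]].
  exists (open_band (a_ext N.+1 a) b N nu i).
  by split=> //; [apply/bands; exists i | exact: card].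
have /card_eq_II -> // : (`I_k #= `I_i)%card.
by apply: card_eq_trans ck; rewrite card_eq_sym; exact: card.
Qed.

Theorem theorem1p2 (R : realType) (q : nat) (a b : nat -> R)
    (hq : (1 <= q)%N)
    (ha : periodic_seq q a) (hb : periodic_seq q b)
    (ha_pos : forall n, (1 <= n)%N -> 0 < a n)
    (j : nat) (hj : (1 <= j <= q)%N) :
  let bound : R := 2 * geomean q a *
    (cos (pi * (j%:R - 1) / q%:R) - cos (pi * j%:R / q%:R)) in
  (lebesgue_measure (band q a b j) <= bound%:E)%E /\
  (lebesgue_measure (band q a b j) = bound%:E <->
     constant_seq a /\ constant_seq b).
Proof.
case: q => // N in hq ha hb hj *; case: j => // i in hj *.
have iN : (i <= N)%N by case/andP: hj.
move=> bound.
have al_gt0 := a_ext_gt0 N ha_pos; have al_per := a_ext_per N a.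
have A0 := geomean_gt0 N ha_pos; have AE := geomean_exp N ha_pos.
have [nu nuP] := dirichlet_roots_interlace b al_gt0.
have boundE : bound = 2 * geomean N.+1 a *
    (cos (i%:R * pi / N.+1%:R) - cos (i.+1%:R * pi / N.+1%:R)).
  by rewrite /bound -[in i.+1%:R - 1]natr1 addrK ![pi * _]mulrC.
have width x y : open_band (a_ext N.+1 a) b N nu i x ->
    open_band (a_ext N.+1 a) b N nu i y -> y - x <= bound.
  by rewrite boundE; exact: (open_band_width al_gt0 al_per nuP A0 AE iN).
have [L [LE BL Lmin]] := measure_closure_interval
  (open_band_interval al_gt0 al_per nuP iN) (open_band_neq0 al_gt0 al_per nuP iN) width.
rewrite (bandE ha_pos nuP iN) LE lee_fin; have Lb := Lmin _ width.
split=> //; split=> [[Leq]|[[ca aE] [cb bE]]].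
- have const : forall n, (n <= N)%N ->
      a_ext N.+1 a n = a_ext N.+1 a 0 /\ b n.+1 = b 1%N.
    (* Otherwise the deficit [d] would also bound the least upper bound [L] by [bound - d], although
       [L] equals [bound]. *)
    apply: contrapT => nconst.
    have [d d0 hd] := open_band_width_strict al_gt0 al_per nuP A0 AE iN nconst.
    by have := Lmin _ hd; rewrite -boundE -Leq; lra.
  split; last by apply: (constant_seq_periodic hb) => n /const[].
  (* The reference value is [a_ext N.+1 a 0], which is [a N.+1] by convention. *)
  have aq n : (n <= N)%N -> a n.+1 = a N.+1.
    rewrite leq_eqVlt => /orP[/eqP ->//|nN].
    by have [] := const _ nN.
  by apply: (constant_seq_periodic ha) => n nN; rewrite !aq.
- congr (_%:E); apply/eqP; rewrite eq_le Lb /= boundE.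
  apply: (open_band_width_const al_gt0 al_per nuP A0 AE iN _ _ BL) => n.
    by rewrite /a_ext; case: n => [|n] /=; rewrite !aE.
  by rewrite !bE.
Qed.
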